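(* Let $\mu$ be a compactly supported probability measure on $\mathbb{P}_n$ and let $\Phi:\mathbb{M}_n\to\mathbb{M}_m$ be a unital positive linear map. Let $\nu$ be the probability measure on $\mathbb{P}_m$ that is the push-forward of $\mu$ under $\Phi$, i.e. $\nu(\mathcal{F})=\mu(\{Z\in\mathbb{P}_n:\Phi(Z)\in\mathcal{F}\})$ for every Borel set $\mathcal{F}\subseteq\mathbb{P}_m$. Then $$\Phi(P_t(\mu))\le P_t(\nu)\qquad\text{for all } t\in[-1,1]\setminus\{0\}.$$
   Context: $\mathbb{M}_n$ is the algebra of $n\times n$ complex matrices, $I$ is the identity matrix, $\mathbb{P}_n\subseteq\mathbb{M}_n$ is the set of positive definite matrices, and $A\le B$ for Hermitian matrices means that $B-A$ is positive semidefinite. A linear map $\Phi:\mathbb{M}_n\to\mathbb{M}_m$ is unital if $\Phi(I)=I$ and positive if it maps positive semidefinite matrices to positive semidefinite matrices (so a unital positive linear map sends $\mathbb{P}_n$ into $\mathbb{P}_m$). Real powers of positive definite matrices are defined by functional calculus. Measures on $\mathbb{P}_n$ are Borel measures, and compactly supported means that the support is a compact subset of $\mathbb{P}_n$. Integrals of matrix-valued functions are Bochner (vector-valued) integrals. For $A,B\in\mathbb{P}_n$ and $t\in[0,1]$ the weighted geometric mean is $A\sharp_t B=A^{1/2}(A^{-1/2}BA^{-1/2})^tA^{1/2}$. Power mean: if $\mu$ is a probability measure of compact support on $\mathbb{P}_n$ and $t\in(0,1]$, then $P_t(\mu)$ denotes the unique solution $X\in\mathbb{P}_n$ of the equation $X=\int_{\mathbb{P}_n}X\sharp_t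 Z\,d\mu(Z)$ (existence and uniqueness are known). For $t\in[-1,0)$, $P_t(\mu)=P_{-t}(\overline{\mu})^{-1}$, where $\overline{\mu}(\mathcal{E})=\mu(\mathcal{E}^{-1})$ for every measurable set $\mathcal{E}$, with $\mathcal{E}^{-1}=\{Z^{-1}:Z\in\mathcal{E}\}$. The same definitions apply on $\mathbb{P}_m$. *)

(* Defs.v *)
From HB Require Import structures.
From mathcomp Require Import all_boot all_order all_algebra.
From mathcomp Require Import sesquilinear spectral.
From mathcomp Require Import complex.
From mathcomp Require Import all_classical all_reals all_analysis.

Set Implicit Arguments.
Unset Strict Implicit.
Unset Printing Implicit Defensive.

Import Order.TTheory GRing.Theory Num.Theory.
Import numFieldNormedType.Exports.

Local Open Scope classical_set_scope.
Local Open Scope ring_scope.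
Local Open Scope sesquilinear_scope.
Local Open Scope complex_scope.

(* The usual topology of the complex numbers. *)
HB.instance Definition _ (R : realType) := PseudoPointedMetric.copy R[i] R[i]^o.

Section MatrixOrder.
Context {R : realType}.
Implicit Types n m : nat.

Definition qform n (A : 'M[R[i]]_n) (x : 'cV[R[i]]_n) : R[i] :=
  (x ^t* *m A *m x) 0 0.

Definition psdmx n (A : 'M[R[i]]_n) : Prop :=
  A \is hermsymmx /\ forall x, 0 <= qform A x.

Definition pdmx n (A : 'M[R[i]]_n) : Prop :=
  A \is hermsymmx /\ forall x, x != 0 -> 0 < qform A x.

Definition loewner_le n (A B : 'M[R[i]]_n) : Prop := psdmx (B - A).

Definition unital_map n m (Phi : 'M[R[i]]_n -> 'M[R[i]]_m) : Prop :=
  Phi 1%:M = 1%:M.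

Definition positive_map n m (Phi : 'M[R[i]]_n -> 'M[R[i]]_m) : Prop :=
  forall A, psdmx A -> psdmx (Phi A).

(* [spectral_diag A] lists the eigenvalues of [A] with multiplicity; they are
   real when [A] is Hermitian, the only case of interest. *)
Definition mxfun n (f : R -> R) (A : 'M[R[i]]_n) : 'M[R[i]]_n :=
  invmx (spectralmx A)
    *m diag_mx (map_mx (fun z : R[i] => (f (complex.Re z))%:C) (spectral_diag A))
    *m spectralmx A.

Definition mxpow n (A : 'M[R[i]]_n) (t : R) : 'M[R[i]]_n :=
  mxfun (fun x => x `^ t) A.

Definition geomean n (t : R) (A B : 'M[R[i]]_n) : 'M[R[i]]_n :=
  mxpow A 2^-1
    *m mxpow (mxpow A (- 2^-1) *m B *m mxpow A (- 2^-1)) t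
    *m mxpow A 2^-1.

Lemma pdmx1 n : pdmx (1%:M : 'M[R[i]]_n).
Proof.
split=> [|x x0]; first exact: hermitian1mx_subproof.
have [i xi] : exists i, x i 0 != 0.
  apply/existsP; apply: contraNT x0; rewrite negb_exists => /forallP x0.
  by apply/eqP/colP => i; rewrite [RHS]mxE; apply/eqP; rewrite -[_ == _]negbK.
rewrite /qform mulmx1 mxE (bigD1 i) //= ltr_wpDr //.
  by apply: sumr_ge0 => j _; rewrite !mxE mulrC mul_conjC_ge0.
by rewrite !mxE mulrC mul_conjC_gt0.
Qed.

Lemma pdmx_unit n (A : 'M[R[i]]_n) : pdmx A -> A \in unitmx.
Proof.
move=> [_ Apos]; rewrite -unitmx_tr -row_free_unit -kermx_eq0.
apply/negPn/negP => /rowV0Pn[v /sub_kermxP vA v0].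
have := Apos v^T; rewrite trmx_eq0 => /(_ v0); rewrite /qform -mulmxA.
have -> : A *m v^T = 0 by rewrite -[A]trmxK -trmx_mul vA trmx0.
by rewrite mulmx0 mxE ltxx.
Qed.

Lemma pdmx_inv n (A : 'M[R[i]]_n) : pdmx A -> pdmx (invmx A).
Proof.
move=> Apd; have Au := pdmx_unit Apd; case: Apd => Ah Apos.
have AhE : A ^t* = A.
  by move/is_hermitianmxP: (Ah) => {2}->; rewrite expr0 scale1r.
have iAhE : (invmx A) ^t* = invmx A.
  by rewrite trmx_inv map_invmx AhE.
split; first by apply/is_hermitianmxP; rewrite expr0 scale1r iAhE.
move=> x x0; have y0 : invmx A *m x != 0.
  by apply: contra x0 => /eqP y0; rewrite -(mulKVmx Au x) y0 mulmx0.
have := Apos _ y0; rewrite /qform trmx_mul map_mxM /= iAhE.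
by rewrite -!mulmxA (mulKVmx Au).
Qed.

End MatrixOrder.

(* The space of positive definite matrices, with the subspace topology and the
   Borel sigma-algebra. *)
Definition PD (R : realType) (n : nat) : Type :=
  set_type [set A : 'M[R[i]]_n | pdmx A].

Section PDSpace.
Context {R : realType} {n : nat}.

HB.instance Definition _ :=
  Topological.copy (PD R n) (set_type [set A : 'M[R[i]]_n | pdmx A]).

Definition PD_val (Z : PD R n) : 'M[R[i]]_n := set_val Z.

Lemma PD_valP (Z : PD R n) : pdmx (PD_val Z).
Proof. exact: set_valP Z. Qed.

Definition mkPD (A : 'M[R[i]]_n) (hA : pdmx A) : PD R n :=
  exist _ A (mem_set hA).

HB.instance Definition _ := isPointed.Build (PD R n) (mkPD (pdmx1 n)).

Definition PD_inv (Z : PD R n) : PD R n := mkPD (pdmx_inv (PD_valP Z)).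

HB.instance Definition _ :=
  Measurable.copy (PD R n) (g_sigma_algebraType (@open (PD R n))).

End PDSpace.

Coercion PD_val : PD >-> matrix.

Section Bochner.
Context {d : measure_display} {T : measurableType d} {R : realType}.
Context {V : normedModType R[i]}.
Implicit Types (mu : set T -> \bar R) (f s : T -> V).

Definition integrable_simple mu s : Prop :=
  [/\ finite_set (range s),
      forall v, measurable (s @^-1` [set v]) &
      forall v, v != 0 -> (mu (s @^-1` [set v]) < +oo)%E].

Definition simple_integral mu s : V :=
  \sum_(v \in range s) (fine (mu (s @^-1` [set v])))%:C *: v.

(* [f] is Borel measurable and approximated in L1 by integrable simple functions
   whose integrals tend to [v].  The norm of [V] takes (real) values in [R[i]],
   whence [complex.Re]. *)
Definition has_bochner_integral mu f (v : V) : Prop :=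
  (forall U : set V, open U -> measurable (f @^-1` U)) /\
  exists s : nat -> T -> V,
    [/\ forall k, integrable_simple mu (s k),
        (\int[mu]_x (complex.Re `|f x - s k x|)%:E)%E @[k --> \oo] --> 0%E &
        simple_integral mu (s k) @[k --> \oo] --> v].

End Bochner.

Section PowerMean.
Context {R : realType} {n : nat}.
Implicit Types mu : set (PD R n) -> \bar R.

Definition msupport mu : set (PD R n) :=
  [set Z | forall U : set (PD R n), open U -> U Z -> (0 < mu U)%E].

Definition is_power_mean mu (t : R) (X : PD R n) : Prop :=
  has_bochner_integral mu (fun Z : PD R n => geomean t X Z) (X : 'M[R[i]]_n).

(* [get] selects the solution of the equation, which is unique for [mu] a
   compactly supported probability measure and [0 < t <= 1]. *)
Definition power_mean_pos mu (t : R) : PD R n :=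
  get [set X | is_power_mean mu t X].

Definition inv_measure mu : set (PD R n) -> \bar R :=
  fun E => mu (PD_inv @` E).

Definition power_mean mu (t : R) : PD R n :=
  if 0 < t then power_mean_pos mu t
  else PD_inv (power_mean_pos (inv_measure mu) (- t)).

End PowerMean.

(* Main.v *)
Require Import Defs.
From HB Require Import structures.
From mathcomp Require Import all_boot all_order all_algebra finmap.
From mathcomp Require Import sesquilinear spectral.
From mathcomp Require Import complex.
From mathcomp Require Import all_classical all_reals all_analysis.
From mathcomp Require Import measurable_realfun ring lra.

Set Implicit Arguments.
Unset Strict Implicit.
Unset Printing Implicit Defensive.

Import Order.TTheory GRing.Theory Num.Theory.
Import numFieldNormedType.Exports.

Local Open Scope classical_set_scope.
Local Open Scope ring_scope.
Local Open Scope sesquilinear_scope.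
Local Open Scope complex_scope.

(** For [0 < t <= 1] the power mean of [mu] is the fixed point of the map
    [mean_op X = \int X #_t Z dmu(Z)] on positive definite matrices.  This map is
    monotone, because the geometric mean is, and homogeneous of degree [1 - t],
    so a comparison principle holds ([mean_op_compare]): a subsolution
    [X <= mean_op X] lies below every supersolution [mean_op Y <= Y].  Indeed, if
    [c >= 1] is least with [X <= c Y], then
    [X <= mean_op (c Y) = c ^ (1 - t) mean_op Y <= c ^ (1 - t) Y], which forces
    [c = 1].

    When [t > 0], Ando's inequality [Phi (X #_t Z) <= Phi X #_t Phi Z], integrated
    against [mu], says that the image under [Phi] of the fixed point for [mu] is a
    subsolution of the equation for [nu] ([map_fixpoint_le]).  When [t < 0], put
    [s = - t] and let [X] solve [X = \int X #_s Z^-1 dmu(Z)], so that the power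
    mean of [mu] is [X^-1].  Then [Phi (X^-1)^-1] is a supersolution of the
    corresponding equation for [nu] ([map_inv_fixpoint_le]): Ando's inequality for
    the inverted arguments reduces the claim to Jensen's inequality for the concave
    map [A |-> Phi (A^-1)^-1], that is, to its tangent bound at [X]
    ([map_inv_supporting]), which is linear in [A] and so commutes with the
    integral.  Inverting the resulting comparison gives the claim.

    Two positive definite matrices are diagonalised by one
    congruence ([pd_simdiag]), and in such coordinates the geometric mean is the
    weighted geometric mean of the diagonals ([geomean_diag]); all its algebraic
    identities follow.  For [t = 1/2] Ando's inequality comes from 2 x 2 block positivity: [Phi]
    preserves positivity of the blocks [A, X, B] with simultaneously diagonal
    entries ([map_block_psd]), and [A #_{1/2} B] is the largest Hermitian [X] that
    makes the block positive ([block_psd_geomean]).  The exponents for which the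
    inequality holds form a closed, midpoint closed set containing [0] and [1],
    hence contain [[0, 1]] ([closed_midpoint_itv], [map_geomean]).  The tangent
    bound is the Schur complement of the same block form ([block_psd_schur]).

    A measure of compact support is concentrated on an order interval
    [aI <= Z <= bI] ([compact_support_order_itv]), where all the integrands are
    bounded Borel functions, and the Bochner integral of such a function is the
    matrix of the integrals of its entries ([bochner_integral_eq],
    [has_bochner_integral_mxint]).  The fixed point exists because the iterates of
    the mean operator from [bI] decrease ([mean_op_fixpoint]); consequently the
    power mean, which is chosen among the solutions of the Bochner equation, really
    is a fixed point ([power_mean_posE]).  The measures [nu] and the two inverted
    measures are images of [mu], so that every integral is taken against [mu]
    ([is_power_meanE]). *)

Local Notation ReC := (@complex.Re _).
Local Notation ImC := (@complex.Im _).
Local Notation "A <<= B" := (loewner_le A B) (at level 70).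

(** * Real and imaginary parts *)

Section ComplexParts.
Context {R : realType}.
Implicit Types z w : R[i].

Lemma ReD z w : ReC (z + w) = ReC z + ReC w. Proof. by case: z w => ? ? []. Qed.
Lemma ImD z w : ImC (z + w) = ImC z + ImC w. Proof. by case: z w => ? ? []. Qed.
Lemma ReN z : ReC (- z) = - ReC z. Proof. by case: z. Qed.
Lemma ImN z : ImC (- z) = - ImC z. Proof. by case: z. Qed.
Lemma ReB z w : ReC (z - w) = ReC z - ReC w. Proof. by rewrite ReD ReN. Qed.
Lemma ImB z w : ImC (z - w) = ImC z - ImC w. Proof. by rewrite ImD ImN. Qed.
Lemma ReM z w : ReC (z * w) = ReC z * ReC w - ImC z * ImC w.
Proof. by case: z w => ? ? []. Qed.
Lemma ImM z w : ImC (z * w) = ReC z * ImC w + ImC z * ReC w.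
Proof. by case: z w => ? ? [] *; rewrite /= addrC. Qed.
Lemma Re_realM (a : R) z : ReC (a%:C * z) = a * ReC z.
Proof. by rewrite ReM /= mul0r subr0. Qed.
Lemma Im_realM (a : R) z : ImC (a%:C * z) = a * ImC z.
Proof. by rewrite ImM /= mul0r addr0. Qed.
Lemma Re_conjC z : ReC (z^*)%R = ReC z. Proof. by case: z. Qed.
Lemma Im_conjC z : ImC (z^*)%R = - ImC z. Proof. by case: z. Qed.

Lemma Re_sum (I : Type) (s : seq I) (P : pred I) (F : I -> R[i]) :
  ReC (\sum_(i <- s | P i) F i) = \sum_(i <- s | P i) ReC (F i).
Proof. by apply: (big_morph _ ReD). Qed.
Lemma Im_sum (I : Type) (s : seq I) (P : pred I) (F : I -> R[i]) :
  ImC (\sum_(i <- s | P i) F i) = \sum_(i <- s | P i) ImC (F i).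
Proof. by apply: (big_morph _ ImD). Qed.

Lemma complexP z w : ReC z = ReC w -> ImC z = ImC w -> z = w.
Proof. by case: z w => ? ? [? ?] /= -> ->. Qed.

Lemma ge0_realC (a : R) : (0 <= a%:C) = (0 <= a).
Proof. exact: ler0c. Qed.
Lemma gt0_realC (a : R) : (0 < a%:C) = (0 < a).
Proof. exact: ltcR. Qed.

End ComplexParts.

(** * Hermitian forms and the Loewner order *)

Section MatrixBasics.
Context {R : realType}.
Implicit Types n m : nat.

Lemma trmxCM m n p (A : 'M[R[i]]_(m, n)) (B : 'M[R[i]]_(n, p)) :
  (A *m B) ^t* = B^t* *m A^t*.
Proof. by rewrite trmx_mul map_mxM. Qed.

Lemma trmxCD m n (A B : 'M[R[i]]_(m, n)) : (A + B) ^t* = A^t* + B^t*.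
Proof. by rewrite linearD /= map_mxD. Qed.

Lemma trmxCN m n (A : 'M[R[i]]_(m, n)) : (- A) ^t* = - A^t*.
Proof. by rewrite linearN /= map_mxN. Qed.

Lemma trmxCB m n (A B : 'M[R[i]]_(m, n)) : (A - B) ^t* = A^t* - B^t*.
Proof. by rewrite trmxCD trmxCN. Qed.

Lemma conj_realC (a : R) : (a%:C^*)%R = a%:C.
Proof. exact: conjc_real. Qed.

Lemma trmxCZ m n (a : R) (A : 'M[R[i]]_(m, n)) : (a%:C *: A) ^t* = a%:C *: A^t*.
Proof. by rewrite linearZ /= map_mxZ; congr (_ *: _); exact: conj_realC. Qed.

Lemma trmxC1 n : (1%:M : 'M[R[i]]_n) ^t* = 1%:M.
Proof. by rewrite trmx1 map_mx1. Qed.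

Lemma trmxCV n (A : 'M[R[i]]_n) : (invmx A) ^t* = invmx (A^t*).
Proof. by rewrite trmx_inv map_invmx. Qed.

Lemma unitmx_trmxC n (A : 'M[R[i]]_n) : (A^t* \in unitmx) = (A \in unitmx).
Proof. by rewrite map_unitmx unitmx_tr. Qed.

Lemma hermP n (A : 'M[R[i]]_n) : A \is hermsymmx <-> A^t* = A.
Proof.
split; first by move/is_hermitianmxP; rewrite expr0 scale1r => {2}->.
by move=> AE; apply/is_hermitianmxP; rewrite expr0 scale1r AE.
Qed.

(** Only the real part of the sesquilinear form is kept: it is a symmetric real
    bilinear form when [A] is Hermitian, which is all that the order and
    polarisation require. *)
Definition sform n (A : 'M[R[i]]_n) (x y : 'cV[R[i]]_n) : R :=
  ReC ((x^t* *m A *m y) 0 0).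

Definition qf n (A : 'M[R[i]]_n) (x : 'cV[R[i]]_n) : R := sform A x x.

Lemma trmxC_00 (M : 'M[R[i]]_1) : (M^t*) 0 0 = ((M 0 0)^*)%R.
Proof. by rewrite !mxE. Qed.

Lemma sformC n (A : 'M[R[i]]_n) x y : A^t* = A -> sform A x y = sform A y x.
Proof.
move=> hA; rewrite /sform -[LHS]Re_conjC -trmxC_00 !trmxCM trmxCK hA.
by rewrite mulmxA.
Qed.

Lemma sformDl n (A : 'M[R[i]]_n) x y z :
  sform A (x + y) z = sform A x z + sform A y z.
Proof. by rewrite /sform trmxCD !mulmxDl mxE ReD. Qed.
Lemma sformDr n (A : 'M[R[i]]_n) x y z :
  sform A x (y + z) = sform A x y + sform A x z.
Proof. by rewrite /sform !mulmxDr mxE ReD. Qed.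
Lemma sformZl n (A : 'M[R[i]]_n) (a : R) x z :
  sform A (a%:C *: x) z = a * sform A x z.
Proof. by rewrite /sform trmxCZ -!scalemxAl mxE Re_realM. Qed.
Lemma sformZr n (A : 'M[R[i]]_n) (a : R) x z :
  sform A x (a%:C *: z) = a * sform A x z.
Proof. by rewrite /sform -!scalemxAr mxE Re_realM. Qed.
Lemma sformNr n (A : 'M[R[i]]_n) x z : sform A x (- z) = - sform A x z.
Proof. by rewrite /sform mulmxN mxE ReN. Qed.
Lemma sformNl n (A : 'M[R[i]]_n) x z : sform A (- x) z = - sform A x z.
Proof. by rewrite /sform trmxCN !mulNmx mxE ReN. Qed.
Lemma sform_addm n (A B : 'M[R[i]]_n) x y :
  sform (A + B) x y = sform A x y + sform B x y.
Proof. by rewrite /sform mulmxDr mulmxDl mxE ReD. Qed.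
Lemma sform_oppm n (A : 'M[R[i]]_n) x y : sform (- A) x y = - sform A x y.
Proof. by rewrite /sform mulmxN mulNmx mxE ReN. Qed.
Lemma sform_scalem n (a : R) (A : 'M[R[i]]_n) x y :
  sform (a%:C *: A) x y = a * sform A x y.
Proof. by rewrite /sform -scalemxAr -scalemxAl mxE Re_realM. Qed.
Lemma sform_summ n (I : Type) (s : seq I) (P : pred I) (F : I -> 'M[R[i]]_n) x y :
  sform (\sum_(i <- s | P i) F i) x y = \sum_(i <- s | P i) sform (F i) x y.
Proof.
apply: (big_morph (fun A => sform A x y)) => [A B|]; first exact: sform_addm.
by rewrite /sform mulmx0 mul0mx mxE.
Qed.
Lemma sform_mulm n p (M N : 'M[R[i]]_(p, n)) (A : 'M[R[i]]_p) x y :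
  sform (M^t* *m A *m N) x y = sform A (M *m x) (N *m y).
Proof. by rewrite /sform trmxCM !mulmxA. Qed.

Lemma sform_mull n p (M : 'M[R[i]]_(p, n)) (A : 'M[R[i]]_p) x y :
  sform A (M *m x) y = ReC ((x^t* *m (M^t* *m A) *m y) 0 0).
Proof. by rewrite /sform trmxCM !mulmxA. Qed.

Lemma qfD n (A B : 'M[R[i]]_n) x : qf (A + B) x = qf A x + qf B x.
Proof. exact: sform_addm. Qed.
Lemma qfN n (A : 'M[R[i]]_n) x : qf (- A) x = - qf A x.
Proof. exact: sform_oppm. Qed.
Lemma qfB n (A B : 'M[R[i]]_n) x : qf (A - B) x = qf A x - qf B x.
Proof. by rewrite qfD qfN. Qed.
Lemma qfZ n (a : R) (A : 'M[R[i]]_n) x : qf (a%:C *: A) x = a * qf A x.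
Proof. exact: sform_scalem. Qed.
Lemma qf_congr n p (M : 'M[R[i]]_(p, n)) (A : 'M[R[i]]_p) x :
  qf (M^t* *m A *m M) x = qf A (M *m x).
Proof. exact: sform_mulm. Qed.
Lemma qfDx n (A : 'M[R[i]]_n) x y : A^t* = A ->
  qf A (x + y) = qf A x + 2 * sform A x y + qf A y.
Proof.
move=> hA; rewrite /qf sformDl !sformDr (sformC y x hA).
move: (sform A x x) (sform A x y) (sform A y y) => u v w; ring.
Qed.
Lemma qf0 n (A : 'M[R[i]]_n) : qf A 0 = 0.
Proof. by rewrite /qf /sform mulmx0 mxE. Qed.

Lemma qformE n (A : 'M[R[i]]_n) x : A^t* = A -> qform A x = (qf A x)%:C.
Proof.
move=> hA; apply: complexP => //=.
have : qform A x = ((qform A x)^*)%R.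
  by rewrite /qform -trmxC_00 !trmxCM trmxCK hA mulmxA.
move/(congr1 ImC); rewrite Im_conjC => /eqP; rewrite -addr_eq0 -mulr2n.
by rewrite mulrn_eq0 /= => /eqP.
Qed.

Lemma psdP n (A : 'M[R[i]]_n) : psdmx A <-> A^t* = A /\ forall x, 0 <= qf A x.
Proof.
split=> -[/hermP hA pA]; split=> //; try exact/hermP; move=> x.
  by have := pA x; rewrite qformE // ge0_realC.
by rewrite qformE ?ge0_realC //; apply/hermP.
Qed.

Lemma pdP n (A : 'M[R[i]]_n) :
  pdmx A <-> A^t* = A /\ forall x, x != 0 -> 0 < qf A x.
Proof.
split=> -[/hermP hA pA]; split=> //; try exact/hermP; move=> x x0.
  by have := pA x x0; rewrite qformE // gt0_realC.
by rewrite qformE ?gt0_realC; [apply: pA | apply/hermP].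
Qed.

Lemma pd_herm n (A : 'M[R[i]]_n) : pdmx A -> A^t* = A. Proof. by case/pdP. Qed.
Lemma psd_herm n (A : 'M[R[i]]_n) : psdmx A -> A^t* = A.
Proof. by case/psdP. Qed.

Lemma pd_psd n (A : 'M[R[i]]_n) : pdmx A -> psdmx A.
Proof.
case/pdP=> hA pA; apply/psdP; split=> // x.
by have [->|/pA/ltW//] := eqVneq x 0; rewrite qf0.
Qed.

Lemma loewnerP n (A B : 'M[R[i]]_n) : A^t* = A -> B^t* = B ->
  (A <<= B <-> forall x, qf A x <= qf B x).
Proof.
move=> hA hB; split=> [/psdP[_ AB] x|AB]; first by rewrite -subr_ge0 -qfB.
by apply/psdP; split=> [|x]; rewrite ?trmxCB ?hA ?hB ?qfB ?subr_ge0.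
Qed.

Lemma loewner_qf n (A B : 'M[R[i]]_n) x : A <<= B -> qf A x <= qf B x.
Proof. by case/psdP=> _ /(_ x); rewrite qfB subr_ge0. Qed.

Lemma psdmx0 n : psdmx (0 : 'M[R[i]]_n).
Proof.
apply/psdP; split=> [|x]; first by rewrite trmx0 map_mx0.
by rewrite /qf /sform mulmx0 mul0mx mxE.
Qed.

Lemma psdD n (A B : 'M[R[i]]_n) : psdmx A -> psdmx B -> psdmx (A + B).
Proof.
move=> /psdP[hA pA] /psdP[hB pB]; apply/psdP; split=> [|x].
  by rewrite trmxCD hA hB.
by rewrite qfD addr_ge0.
Qed.

Lemma psdZ n (a : R) (A : 'M[R[i]]_n) : 0 <= a -> psdmx A -> psdmx (a%:C *: A).
Proof.
move=> a0 /psdP[hA pA]; apply/psdP; split=> [|x]; first by rewrite trmxCZ hA.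
by rewrite qfZ mulr_ge0.
Qed.

Lemma pdZ n (a : R) (A : 'M[R[i]]_n) : 0 < a -> pdmx A -> pdmx (a%:C *: A).
Proof.
move=> a0 /pdP[hA pA]; apply/pdP; split=> [|x x0]; first by rewrite trmxCZ hA.
by rewrite qfZ mulr_gt0 // pA.
Qed.

Lemma psd_congr n p (M : 'M[R[i]]_(p, n)) (A : 'M[R[i]]_p) :
  psdmx A -> psdmx (M^t* *m A *m M).
Proof.
move=> /psdP[hA pA]; apply/psdP; split=> [|x]; last by rewrite qf_congr.
by rewrite !trmxCM trmxCK hA mulmxA.
Qed.

Lemma pd_congr n (M : 'M[R[i]]_n) (A : 'M[R[i]]_n) : M \in unitmx ->
  pdmx A -> pdmx (M^t* *m A *m M).
Proof.
move=> Mu /pdP[hA pA]; apply/pdP; split=> [|x x0].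
  by rewrite !trmxCM trmxCK hA mulmxA.
rewrite qf_congr pA //; apply: contra x0 => /eqP Mx0.
by rewrite -(mulKmx Mu x) Mx0 mulmx0.
Qed.

Lemma loewner_refl n (A : 'M[R[i]]_n) : A <<= A.
Proof. by rewrite /loewner_le subrr; exact: psdmx0. Qed.

Lemma loewner_trans n (B A C : 'M[R[i]]_n) : A <<= B -> B <<= C -> A <<= C.
Proof.
by move=> AB BC; have := psdD BC AB; rewrite addrA subrK.
Qed.

Lemma loewnerZ n (a : R) (A B : 'M[R[i]]_n) : 0 <= a -> A <<= B ->
  a%:C *: A <<= a%:C *: B.
Proof. by move=> a0 AB; rewrite /loewner_le -scalerBr; apply: psdZ. Qed.

Lemma loewner_congr n p (M : 'M[R[i]]_(p, n)) (A B : 'M[R[i]]_p) : A <<= B ->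
  M^t* *m A *m M <<= M^t* *m B *m M.
Proof.
by move=> AB; rewrite /loewner_le -mulmxBl -mulmxBr; apply: psd_congr.
Qed.

Lemma loewner_scale n (a b : R) (A : 'M[R[i]]_n) : a <= b -> psdmx A ->
  a%:C *: A <<= b%:C *: A.
Proof.
move=> ab Ap; rewrite /loewner_le -scalerBl -rmorphB.
by apply: psdZ; rewrite ?subr_ge0.
Qed.

Lemma pd_loewner n (A B : 'M[R[i]]_n) : pdmx A -> A <<= B -> pdmx B.
Proof.
move=> /pdP[hA pA] AB; apply/pdP; split=> [|x x0]; last first.
  by apply: lt_le_trans (pA x x0) (loewner_qf x AB).
by have /psd_herm := AB; rewrite trmxCB hA => /addIr.
Qed.

(** * Diagonal matrices and the functional calculus *)

Definition dmx n (d : 'I_n -> R) : 'M[R[i]]_n := diag_mx (\row_i (d i)%:C).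

Lemma trmxC_dmx n (d : 'I_n -> R) : (dmx d) ^t* = dmx d.
Proof.
rewrite /dmx tr_diag_mx map_diag_mx; congr diag_mx; apply/rowP => i.
by rewrite !mxE /= conj_realC.
Qed.

Lemma mul_dmx n (d e : 'I_n -> R) : dmx d *m dmx e = dmx (fun i => d i * e i).
Proof.
rewrite /dmx mulmx_diag; congr diag_mx; apply/rowP => i.
by rewrite !mxE rmorphM.
Qed.

Lemma dmx1 n : dmx (fun=> 1 : R) = 1%:M :> 'M[R[i]]_n.
Proof.
by apply/matrixP => i j; rewrite !mxE.
Qed.

Lemma eq_dmx n (d e : 'I_n -> R) : d =1 e -> dmx d = dmx e.
Proof. by move=> de; congr diag_mx; apply/rowP => i; rewrite !mxE de. Qed.

Lemma eq_congr_dmx n p (S T : 'M[R[i]]_(n, p)) (d e : 'I_n -> R) : d =1 e ->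
  S^t* *m dmx d *m T = S^t* *m dmx e *m T.
Proof. by move=> /eq_dmx ->. Qed.

Definition normsq n (x : 'cV[R[i]]_n) : R := qf 1%:M x.

Definition csq (z : R[i]) : R := ReC z ^+ 2 + ImC z ^+ 2.

Lemma csq_ge0 z : 0 <= csq z.
Proof. by rewrite addr_ge0 // sqr_ge0. Qed.

Lemma qf_dmx n (d : 'I_n -> R) x : qf (dmx d) x = \sum_i d i * csq (x i 0).
Proof.
rewrite /qf /sform mul_mx_diag mxE Re_sum; apply: eq_bigr => i _.
rewrite !mxE /= /csq !ReM !ImM Re_conjC Im_conjC /=; ring.
Qed.

Lemma normsqE n (x : 'cV[R[i]]_n) : normsq x = \sum_i csq (x i 0).
Proof.
by rewrite /normsq -dmx1 qf_dmx; apply: eq_bigr => i _; rewrite mul1r.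
Qed.

Lemma normsq_ge0 n (x : 'cV[R[i]]_n) : 0 <= normsq x.
Proof. by rewrite normsqE sumr_ge0 // => i _; apply: csq_ge0. Qed.

Lemma normsq_gt0 n (x : 'cV[R[i]]_n) : x != 0 -> 0 < normsq x.
Proof. by case/pdP: (@pdmx1 R n) => _ /(_ x). Qed.

Lemma qf_trmxCM n (M : 'M[R[i]]_n) x : qf (M^t* *m M) x = normsq (M *m x).
Proof. by rewrite -[M^t*]mulmx1 qf_congr. Qed.

Lemma psd_dmx n (d : 'I_n -> R) : (forall i, 0 <= d i) -> psdmx (dmx d).
Proof.
move=> d0; apply/psdP; split=> [|x]; first exact: trmxC_dmx.
by rewrite qf_dmx sumr_ge0 // => i _; rewrite mulr_ge0 ?csq_ge0.
Qed.

Lemma pd_dmx n (d : 'I_n -> R) : (forall i, 0 < d i) -> pdmx (dmx d).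
Proof.
move=> d0; apply/pdP; split=> [|x x0]; first exact: trmxC_dmx.
have : 0 < normsq x by exact: normsq_gt0.
rewrite qf_dmx normsqE => /lt0r_neq0; rewrite psumr_eq0; last first.
  by move=> i _; exact: csq_ge0.
move=> /allPn[i _]; rewrite implyTb => xi; rewrite (bigD1 i) //=.
rewrite ltr_wpDr ?mulr_gt0 // ?sumr_ge0 // => [j _|].
  by rewrite mulr_ge0 ?csq_ge0 // ltW.
by rewrite lt_def xi csq_ge0.
Qed.

Lemma qf_delta n (A : 'M[R[i]]_n) i : qf A (delta_mx i 0) = ReC (A i i).
Proof.
rewrite /qf /sform; congr complex.Re.
rewrite trmx_delta map_delta_mx -rowE.
by rewrite -colE !mxE.
Qed.

Lemma pd_dmx_gt0 n (d : 'I_n -> R) i : pdmx (dmx d) -> 0 < d i.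
Proof.
case/pdP=> _ /(_ (delta_mx i 0)); rewrite qf_delta !mxE eqxx mulr1n /=; apply.
apply/eqP => /matrixP /(_ i 0); rewrite !mxE !eqxx => /eqP.
by rewrite oner_eq0.
Qed.

Lemma dmx_delta n (d : 'I_n -> R) i :
  dmx d *m delta_mx i (0 : 'I_1) = (d i)%:C *: delta_mx i 0.
Proof.
apply/matrixP => j k; rewrite mul_diag_mx !mxE.
by have [->|] := eqVneq j i; rewrite ?mulr0.
Qed.

Lemma unitary_adj n (U : 'M[R[i]]_n) : U \is unitarymx -> U^t* *m U = 1%:M.
Proof.
by move=> Uu; rewrite -invmx_unitary // mulVmx // unitarymx_unit.
Qed.

Lemma adj_unitary n (U : 'M[R[i]]_n) : U^t* *m U = 1%:M -> U *m U^t* = 1%:M.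
Proof. exact: mulmx1C. Qed.

Lemma mul_similar n (U V D E : 'M[R[i]]_n) : U *m V = 1%:M ->
  (V *m D *m U) *m (V *m E *m U) = V *m (D *m E) *m U.
Proof. by move=> UV; rewrite !mulmxA -(mulmxA _ U) UV mulmx1. Qed.

(** The real spectral theorem, together with the value of the functional calculus in
    the eigenbasis that defines it. *)
Lemma hermitian_spectral n (A : 'M[R[i]]_n) : A^t* = A ->
  exists (U : 'M[R[i]]_n) (d : 'I_n -> R), [/\ U^t* *m U = 1%:M,
    A = U^t* *m dmx d *m U & forall f, mxfun f A = U^t* *m dmx (f \o d) *m U].
Proof.
move=> /hermP hA; have Uu := spectral_unitarymx A.
have UV := invmx_unitary Uu.
have /hermitian_normalmx/orthomx_spectralP AE := hA.
have /mxOverP dr := hermitian_spectral_diag_real hA.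
rewrite UV in AE; have UU := unitary_adj Uu.
exists (spectralmx A), (fun i => ReC (spectral_diag A 0 i)); split.
- exact: UU.
- rewrite {1}AE /dmx; do 2 congr mulmx; congr diag_mx; apply/rowP => i.
  by rewrite mxE RRe_real.
- move=> f; rewrite /mxfun UV /dmx; do 2 congr mulmx; congr diag_mx.
  by apply/rowP => i; rewrite !mxE.
Qed.

(** The calculus does not depend on the diagonalisation.  If [U] and [V] diagonalise
    the same matrix, the unitary [W = V U^-1] intertwines the two diagonals; read
    entrywise this says that [W i j] vanishes unless the eigenvalues [e i] and [d j]
    agree, so [W] intertwines [f \o d] and [f \o e] as well. *)
Lemma mxfun_diag n (f : R -> R) (U : 'M[R[i]]_n) (d : 'I_n -> R) :
  U^t* *m U = 1%:M -> mxfun f (U^t* *m dmx d *m U) = U^t* *m dmx (f \o d) *m U.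
Proof.
move=> UU; have UU' := adj_unitary UU.
set A := _ *m U; have hA : A^t* = A.
  by rewrite /A !trmxCM trmxCK trmxC_dmx mulmxA.
have [V [e [VV AE fE]]] := hermitian_spectral hA; rewrite fE.
have VV' := adj_unitary VV.
have [W [WV WU WW]] : exists W : 'M[R[i]]_n,
    [/\ W *m U = V, V *m U^t* = W & W^t* *m W = 1%:M].
  exists (V *m U^t*); split; [by rewrite -mulmxA UU mulmx1 | by [] |].
  by rewrite trmxCM trmxCK mulmxA -(mulmxA U) VV mulmx1 UU'.
have WE : W *m dmx d = dmx e *m W.
  have : V *m A *m U^t* = W *m dmx d.
    by rewrite /A !mulmxA WU -mulmxA UU' mulmx1.
  by rewrite AE !mulmxA VV' mul1mx -mulmxA WU.
have {}WE : W *m dmx (f \o d) = dmx (f \o e) *m W.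
  apply/matrixP => i j; move/matrixP/(_ i j): WE.
  rewrite /dmx !mul_diag_mx !mul_mx_diag !mxE /= mulrC => /eqP.
  rewrite -subr_eq0 -mulrBl mulf_eq0 => /orP[|/eqP ->]; last first.
    by rewrite mulr0 mul0r.
  by rewrite subr_eq0 => /eqP/complexI ->; rewrite mulrC.
rewrite -WV trmxCM; move: (W^t*) (U^t*) (dmx _) (dmx _) WE WW => W' U' D E WE WW.
by rewrite !mulmxA -(mulmxA _ D) -WE -(mulmxA _ W') (mulmxA W') WW mul1mx.
Qed.

Lemma pd_spectral n (A : 'M[R[i]]_n) : pdmx A ->
  exists (U : 'M[R[i]]_n) (d : 'I_n -> R), [/\ U^t* *m U = 1%:M, forall i, 0 < d i,
    A = U^t* *m dmx d *m U & forall f, mxfun f A = U^t* *m dmx (f \o d) *m U].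
Proof.
move=> Apd; have [U [d [UU AE fE]]] := hermitian_spectral (pd_herm Apd).
have [Uu _] := mulmx1_unit UU; have UU' := adj_unitary UU.
exists U, d; split=> // i.
have : pdmx ((U^t*)^t* *m A *m U^t*) by exact: pd_congr Apd.
rewrite trmxCK AE !mulmxA UU' mul1mx -mulmxA UU' mulmx1.
exact: pd_dmx_gt0.
Qed.

(** In finite dimension positive definiteness is uniform: the inverse of
    [1 + \sum_i 1 / d i] is below every eigenvalue [d i] and needs no minimum over a
    possibly empty index set. *)
Lemma pd_lower_bound n (A : 'M[R[i]]_n) : pdmx A ->
  exists2 e : R, 0 < e & loewner_le (e%:C *: 1%:M) A.
Proof.
move=> Apd; have [U [d [UU d0 AE _]]] := pd_spectral Apd.
pose s := 1 + \sum_i (d i)^-1.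
have s0 : 0 < s.
  by rewrite ltr_wpDr // sumr_ge0 // => i _; rewrite invr_ge0 ltW.
exists s^-1; first by rewrite invr_gt0.
have -> : s^-1%:C *: 1%:M = U^t* *m dmx (fun=> s^-1) *m U.
  have -> : dmx (fun=> s^-1) = s^-1%:C *: 1%:M :> 'M[R[i]]_n.
    by apply/matrixP => i j; rewrite !mxE -mulr_natr.
  by rewrite -scalemxAr -scalemxAl mulmx1 UU.
rewrite AE; apply: loewner_congr; rewrite /loewner_le.
have -> : dmx d - dmx (fun=> s^-1) = dmx (fun i => d i - s^-1).
  by apply/matrixP => i j; rewrite !mxE -mulrnBl rmorphB.
apply: psd_dmx => i; rewrite subr_ge0 -(invrK (d i)) lef_pV2 ?posrE ?invr_gt0 //.
rewrite /s (bigD1 i) //= addrCA lerDl addr_ge0 // sumr_ge0 // => j _.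
by rewrite invr_ge0 ltW.
Qed.

Section Powers.
Variables (n : nat) (A : 'M[R[i]]_n).
Hypothesis Apd : pdmx A.

Lemma mxpowD s t : mxpow A s *m mxpow A t = mxpow A (s + t).
Proof.
have [U [d [UU d0 _ fE]]] := pd_spectral Apd; have UU' := adj_unitary UU.
rewrite /mxpow !fE (mul_similar _ _ UU') mul_dmx.
apply: eq_congr_dmx => i /=; rewrite powRD //; apply/implyP => _.
by rewrite gt_eqF.
Qed.

Lemma mxpow1 : mxpow A 1 = A.
Proof.
have [U [d [UU d0 AE fE]]] := pd_spectral Apd.
rewrite /mxpow fE [RHS]AE; apply: eq_congr_dmx => i /=.
by rewrite powRr1 // ltW.
Qed.

Lemma mxpow0 : mxpow A 0 = 1%:M.
Proof.
have [U [d [UU d0 AE fE]]] := pd_spectral Apd.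
rewrite /mxpow fE (eq_dmx (e := fun=> 1)) => [|i /=]; last by rewrite powRr0.
by rewrite dmx1 mulmx1.
Qed.

Lemma pd_mxpow t : pdmx (mxpow A t).
Proof.
have [U [d [UU d0 AE fE]]] := pd_spectral Apd.
rewrite /mxpow fE; apply: pd_congr; last by apply: pd_dmx => i; rewrite powR_gt0.
by have [] := mulmx1_unit UU.
Qed.

End Powers.

End MatrixBasics.

(** * Midpoint closed sets of exponents *)

Section MidpointConvexity.
Context {R : realType}.

(** Seen from above by [t |-> 1 - t], the same fact gives the nearest element of [S]
    on the other side of a point. *)
Lemma closed_last_below (S : set R) (t : R) : closed S -> S 0 -> 0 <= t ->
  exists a, [/\ 0 <= a, a <= t, S a & forall s, S s -> s <= t -> s <= a].
Proof.
move=> Scl S0 t0; pose L := S `&` [set s | s <= t].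
have L0 : L 0 by [].
have Lub : has_ubound L by exists t => s [].
have Lcl : closed L by apply: closedI => //; apply: closed_le.
have [Sa at_] : L (sup L) by apply: Lcl; apply: closure_sup => //; exists 0.
exists (sup L); split=> //; first exact: ub_le_sup.
by move=> s Ss st; apply: ub_le_sup.
Qed.

(** If [t] were missing, the midpoint of the nearest elements of [S] on either side
    of [t] would be nearer. *)
Lemma closed_midpoint_itv (S : set R) : closed S -> S 0 -> S 1 ->
  (forall r s, 0 <= r <= 1 -> 0 <= s <= 1 -> S r -> S s -> S ((r + s) / 2)) ->
  forall t, 0 <= t <= 1 -> S t.
Proof.
move=> Scl S0 S1 Smid t /andP[t0 t1].
have [a [a0 at_ Sa aP]] := closed_last_below Scl S0 t0.
have Scl' : closed ((fun s => 1 - s) @^-1` S).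
  apply: preimage_closed => // x _.
  by apply: cvgB; [exact: cvg_cst | exact: cvg_id].
have S0' : ((fun s => 1 - s) @^-1` S) 0 by rewrite /= subr0.
have t1' : 0 <= 1 - t by rewrite subr_ge0.
have [b [b0 bt Sb bP]] := closed_last_below Scl' S0' t1'.
have [->//|nat_] := eqVneq t a.
have [->|nbt] := eqVneq t (1 - b); first exact: Sb.
have a_lt : a < t by rewrite lt_def nat_.
have b_lt : t < 1 - b by rewrite lt_def eq_sym nbt /=; lra.
have Sm : S ((a + (1 - b)) / 2) by apply: Smid => //; apply/andP; split; lra.
have [mt|mt] := leP ((a + (1 - b)) / 2) t.
  by have := aP _ Sm mt; lra.
have : ((fun s => 1 - s) @^-1` S) (1 - (a + (1 - b)) / 2).
  by rewrite /= subKr.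
by move/bP; lra.
Qed.

End MidpointConvexity.

(** * Weighted geometric means *)

Section GeometricMean.
Context {R : realType}.
Implicit Types n m : nat.

Lemma powRD_gt0 (a r s : R) : 0 < a -> a `^ (r + s) = a `^ r * a `^ s.
Proof. by move=> a0; rewrite powRD //; apply/implyP => _; rewrite gt_eqF. Qed.

Lemma powRV (a t : R) : 0 < a -> a^-1 `^ t = (a `^ t)^-1.
Proof.
by move=> a0; rewrite -[a^-1]powR_inv1 ?ltW // -powRrM mulN1r powRN.
Qed.

Lemma powR_half (a : R) : 0 < a -> a `^ 2^-1 * a `^ 2^-1 = a.
Proof.
move=> a0; rewrite -powRD_gt0 //.
by rewrite -[X in X + _]mul1r -[X in _ + X]mul1r -splitr powRr1 // ltW.
Qed.

(** The square root [H] of [A] and its inverse [K] enter computations only through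
    these identities; as variables they keep the spectral definition from being
    unfolded. *)
Lemma mxpow_sqrt n (A : 'M[R[i]]_n) : pdmx A ->
  exists H K : 'M[R[i]]_n,
    [/\ mxpow A 2^-1 = H, mxpow A (- 2^-1) = K, H *m H = A &
        [/\ H *m K = 1%:M, K *m H = 1%:M, H^t* = H & K^t* = K]].
Proof.
move=> Apd.
have HK := mxpowD Apd 2^-1 (- 2^-1); rewrite subrr mxpow0 // in HK.
have HH := mxpowD Apd 2^-1 2^-1.
rewrite -[X in X + _]mul1r -[X in _ + X]mul1r -splitr mxpow1 // in HH.
have hH := pd_herm (pd_mxpow Apd 2^-1).
have hK := pd_herm (pd_mxpow Apd (- 2^-1)).
move: (mxpow A 2^-1) (mxpow A (- 2^-1)) HK HH hH hK => H K HK HH hH hK.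
by exists H, K; split=> //; split=> //; apply: mulmx1C.
Qed.

Lemma scale_dmx n (k : R) (d : 'I_n -> R) :
  k%:C *: dmx d = dmx (fun i => k * d i).
Proof. by apply/matrixP => i j; rewrite !mxE mulrnAr rmorphM. Qed.

Section SimultaneousDiagonal.
Context {n : nat}.
Implicit Types (S : 'M[R[i]]_n) (a b d : 'I_n -> R).

(** With [A = S^* S] and [H] the square root of [A], the matrix [W = S H^-1] is
    unitary and diagonalises [H^-1 B H^-1]; so the definition of the mean collapses
    to [S] and the powers of [d]. *)
Lemma geomean_gram t S d : S \in unitmx -> (forall i, 0 < d i) ->
  geomean t (S^t* *m dmx (fun=> 1) *m S) (S^t* *m dmx d *m S) =
  S^t* *m dmx (fun i => d i `^ t) *m S.
Proof.
move=> Su d0; rewrite dmx1 mulmx1; set A := S^t* *m S.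
have Apd : pdmx A.
  by rewrite /A -[S^t*]mulmx1; apply: pd_congr Su _; apply: pdmx1.
rewrite /geomean; have [H [K [HE KE HH [HK KH hH hK]]]] := mxpow_sqrt Apd.
rewrite HE KE; pose W := S *m K.
have WW : W^t* *m W = 1%:M.
  rewrite /W trmxCM hK -mulmxA (mulmxA _ S) -/A -HH.
  by rewrite -mulmxA HK mulmx1 KH.
have -> : K *m (S^t* *m dmx d *m S) *m K = W^t* *m dmx d *m W.
  by rewrite /W trmxCM hK !mulmxA.
rewrite /mxpow mxfun_diag // -/(mxpow _ _).
have SE : W *m H = S by rewrite /W -mulmxA KH mulmx1.
by clearbody W; rewrite -SE trmxCM hH !mulmxA.
Qed.

(** The geometric mean is entrywise in any coordinates, not only orthonormal ones, in
    which both matrices are diagonal.  The square root of [a] is absorbed into [S] to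
    reduce to the case [a = 1]. *)
Lemma geomean_diag t S a b : S \in unitmx ->
  (forall i, 0 < a i) -> (forall i, 0 < b i) ->
  geomean t (S^t* *m dmx a *m S) (S^t* *m dmx b *m S) =
  S^t* *m dmx (fun i => a i `^ (1 - t) * b i `^ t) *m S.
Proof.
move=> Su a0 b0; pose d i := b i / a i.
have d0 i : 0 < d i by rewrite divr_gt0.
have [r ru rdr] : exists2 r : 'M[R[i]]_n, r \in unitmx &
    forall e : 'I_n -> R, (r *m S)^t* *m dmx e *m (r *m S) =
      S^t* *m dmx (fun i => a i * e i) *m S.
  exists (dmx (fun i => a i `^ 2^-1)) => [|e].
    by apply/pdmx_unit/pd_dmx => i; rewrite powR_gt0.
  rewrite trmxCM trmxC_dmx mulmxA -[_ *m dmx e]mulmxA mul_dmx.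
  rewrite -[_ *m dmx (fun i => a i `^ 2^-1)]mulmxA mul_dmx.
  apply: eq_congr_dmx => i.
  by rewrite mulrAC powR_half.
have rSu : r *m S \in unitmx by rewrite unitmx_mul ru.
have := geomean_gram t rSu d0.
rewrite !rdr.
rewrite (eq_dmx (d := fun i => a i * 1) (e := a)) => [|i]; last first.
  by rewrite mulr1.
rewrite (eq_dmx (d := fun i => a i * d i) (e := b)) => [|i]; last first.
  by rewrite /d mulrC divfK // gt_eqF.
move=> ->; apply: eq_congr_dmx => i.
rewrite /d powRM ?ltW ?invr_gt0 // powRV // mulrCA mulrC; congr (_ * _).
by rewrite powRD_gt0 // powRr1 ?powRN // ltW.
Qed.

End SimultaneousDiagonal.

(** Diagonalising [H^-1 B H^-1], with [H] the square root of [A], by a unitary [U]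
    gives the congruence [S = U H]. *)
Lemma pd_gram n (A B : 'M[R[i]]_n) : pdmx A -> pdmx B ->
  exists (S : 'M[R[i]]_n) (d : 'I_n -> R),
    [/\ S \in unitmx, forall i, 0 < d i,
        A = S^t* *m dmx (fun=> 1) *m S & B = S^t* *m dmx d *m S].
Proof.
move=> Apd Bpd; have [H [K [HE KE HH [HK KH hH hK]]]] := mxpow_sqrt Apd.
have [Hu Ku] := mulmx1_unit HK.
have Cpd : pdmx (K^t* *m B *m K) by exact: pd_congr.
have [U [d [UU d0 CE _]]] := pd_spectral Cpd.
exists (U *m H), d; split; first by rewrite unitmx_mul (mulmx1_unit UU).2.
- exact: d0.
- by rewrite dmx1 mulmx1 trmxCM -mulmxA (mulmxA _ U) UU mul1mx hH.
- have -> : (U *m H)^t* *m dmx d *m (U *m H) = H *m (K^t* *m B *m K) *m H.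
    by rewrite CE trmxCM hH !mulmxA.
  by rewrite hK !mulmxA HK mul1mx -mulmxA KH mulmx1.
Qed.

(** A symmetric form of [pd_gram], suited to identities in which neither matrix plays
    a special part. *)
Lemma pd_simdiag n (A B : 'M[R[i]]_n) : pdmx A -> pdmx B ->
  exists (S : 'M[R[i]]_n) (a b : 'I_n -> R),
    [/\ S \in unitmx, forall i, 0 < a i, forall i, 0 < b i,
        A = S^t* *m dmx a *m S & B = S^t* *m dmx b *m S].
Proof.
move=> Apd Bpd; have [S [d [Su d0 AE BE]]] := pd_gram Apd Bpd.
by exists S, (fun=> 1), d; split.
Qed.

Section GeomeanTheory.
Context {n : nat}.
Implicit Types A B : 'M[R[i]]_n.

Lemma pd_geomean t A B : pdmx A -> pdmx B -> pdmx (geomean t A B).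
Proof.
move=> Apd Bpd; have [S [a [b [Su a0 b0 -> ->]]]] := pd_simdiag Apd Bpd.
rewrite (geomean_diag _ Su a0 b0); apply: pd_congr Su _; apply: pd_dmx => i.
by rewrite mulr_gt0 ?powR_gt0.
Qed.

Lemma geomean_t0 A B : pdmx A -> pdmx B -> geomean 0 A B = A.
Proof.
move=> Apd Bpd; have [S [a [b [Su a0 b0 -> ->]]]] := pd_simdiag Apd Bpd.
rewrite (geomean_diag _ Su a0 b0); apply: eq_congr_dmx => i.
by rewrite subr0 powRr0 mulr1 powRr1 // ltW.
Qed.

Lemma geomean_t1 A B : pdmx A -> pdmx B -> geomean 1 A B = B.
Proof.
move=> Apd Bpd; have [S [a [b [Su a0 b0 -> ->]]]] := pd_simdiag Apd Bpd.
rewrite (geomean_diag _ Su a0 b0); apply: eq_congr_dmx => i.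
by rewrite subrr powRr0 mul1r powRr1 // ltW.
Qed.

Lemma geomean_id t A : pdmx A -> geomean t A A = A.
Proof.
move=> Apd; have [S [a [b [Su a0 b0 -> _]]]] := pd_simdiag Apd Apd.
rewrite (geomean_diag _ Su a0 a0); apply: eq_congr_dmx => i.
by rewrite -powRD_gt0 // subrK powRr1 // ltW.
Qed.

(** Along [t |-> A #_t B] the midpoint of two parameters is the midpoint mean; this
    passes from the exponent [1/2] to the dyadic ones. *)
Lemma geomean_mid r s A B : pdmx A -> pdmx B ->
  geomean 2^-1 (geomean r A B) (geomean s A B) = geomean ((r + s) / 2) A B.
Proof.
move=> Apd Bpd; have [S [a [b [Su a0 b0 -> ->]]]] := pd_simdiag Apd Bpd.
have c0 t i : 0 < a i `^ (1 - t) * b i `^ t by rewrite mulr_gt0 ?powR_gt0.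
rewrite (geomean_diag r Su a0 b0) (geomean_diag s Su a0 b0).
rewrite (geomean_diag _ Su (c0 r) (c0 s)) (geomean_diag _ Su a0 b0).
apply: eq_congr_dmx => i; rewrite !powRM ?powR_ge0 // -!powRrM mulrACA -!powRD_gt0 //.
by congr (_ `^ _ * _ `^ _); lra.
Qed.

Lemma geomean_scale t (c e : R) A B : 0 < c -> 0 < e -> pdmx A -> pdmx B ->
  geomean t (c%:C *: A) (e%:C *: B) = (c `^ (1 - t) * e `^ t)%:C *: geomean t A B.
Proof.
move=> c0 e0 Apd Bpd; have [S [a [b [Su a0 b0 -> ->]]]] := pd_simdiag Apd Bpd.
have dZ (k : R) (d : 'I_n -> R) :
    k%:C *: (S^t* *m dmx d *m S) = S^t* *m dmx (fun i => k * d i) *m S.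
  by rewrite scalemxAl scalemxAr scale_dmx.
have ca0 i : 0 < c * a i by rewrite mulr_gt0.
have eb0 i : 0 < e * b i by rewrite mulr_gt0.
rewrite (dZ c a) (dZ e b) (geomean_diag _ Su ca0 eb0) (geomean_diag _ Su a0 b0).
rewrite dZ.
apply: eq_congr_dmx => i.
by rewrite !powRM ?ltW // mulrACA.
Qed.

Lemma geomean_inv t A B : pdmx A -> pdmx B ->
  geomean t (invmx A) (invmx B) = invmx (geomean t A B).
Proof.
move=> Apd Bpd; have [S [a [b [Su a0 b0 -> ->]]]] := pd_simdiag Apd Bpd.
have dV (d : 'I_n -> R) : (forall i, 0 < d i) ->
    invmx (S^t* *m dmx d *m S) =
    ((invmx S)^t*)^t* *m dmx (fun i => (d i)^-1) *m (invmx S)^t*.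
  move=> d0; have Spd : pdmx (S^t* *m dmx d *m S).
    by apply: pd_congr Su _; apply: pd_dmx.
  apply: (can_inj (mulKmx (pdmx_unit Spd))); rewrite mulmxV ?pdmx_unit //.
  rewrite trmxCK trmxCV -!mulmxA (mulmxA S) mulmxV // mul1mx (mulmxA (dmx d)).
  rewrite mul_dmx (eq_dmx (e := fun=> 1)) ?dmx1 ?mul1mx ?mulmxV ?unitmx_trmxC //.
  by move=> i; rewrite mulfV // gt_eqF.
have Su' : (invmx S)^t* \in unitmx by rewrite unitmx_trmxC unitmx_inv.
have a0' i : 0 < (a i)^-1 by rewrite invr_gt0.
have b0' i : 0 < (b i)^-1 by rewrite invr_gt0.
have c0 i : 0 < a i `^ (1 - t) * b i `^ t by rewrite mulr_gt0 ?powR_gt0.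
rewrite (geomean_diag _ Su a0 b0) (dV _ a0) (dV _ b0) (dV _ c0).
rewrite (geomean_diag _ Su' a0' b0').
apply: eq_congr_dmx => i.
by rewrite (powRV _ (a0 i)) (powRV _ (b0 i)) invfM.
Qed.

End GeomeanTheory.

End GeometricMean.

(** * Block positivity and inequalities for positive maps *)

Section BlockForms.
Context {R : realType}.

Section BlockPositivity.
Context {n : nat}.
Implicit Types A B X : 'M[R[i]]_n.

(** Positivity of the Hermitian block matrix with diagonal [A], [B] and off-diagonal
    blocks [X], evaluated at the vector [(x, y)]. *)
Definition block_psd A X B : Prop :=
  forall x y, 0 <= qf A x + 2 * sform X x y + qf B y.

Lemma block_psd_le A B A' B' X : A <<= A' -> B <<= B' ->
  block_psd A X B -> block_psd A' X B'.
Proof.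
move=> AA BB AXB x y; apply: le_trans (AXB x y) _.
by rewrite lerD ?lerD ?loewner_qf.
Qed.

(** The form is evaluated at its minimiser in the first variable,
    [x = - A^-1 X y]. *)
Lemma block_psd_schur A X B : pdmx A -> X^t* = X -> B^t* = B ->
  block_psd A X B -> X *m invmx A *m X <<= B.
Proof.
move=> Apd hX hB AXB; have Au := pdmx_unit Apd; have hA := pd_herm Apd.
have hV : (invmx A)^t* = invmx A by rewrite trmxCV hA.
have hXAX : (X *m invmx A *m X)^t* = X *m invmx A *m X.
  by rewrite !trmxCM hV hX mulmxA.
apply/(loewnerP hXAX hB) => y.
have := AXB (- (invmx A *m X *m y)) y.
have -> : qf A (- (invmx A *m X *m y)) = qf (X *m invmx A *m X) y.
  rewrite /qf sformNl sformNr opprK -sform_mulm trmxCM hV hX.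
  by rewrite -(mulmxA (_ *m _) A) mulKVmx // mulmxA.
have -> : sform X (- (invmx A *m X *m y)) y = - qf (X *m invmx A *m X) y.
  by rewrite sformNl sform_mull trmxCM hV hX.
by move: (qf _ y) (qf B y) => u v; lra.
Qed.

(** Comparing squares suffices to compare: on an eigenvector of [E - Y] with a
    negative eigenvalue, [Y ^ 2] would exceed [E ^ 2]. *)
Lemma psd_sqr_le (Y E : 'M[R[i]]_n) : Y^t* = Y -> psdmx E ->
  Y *m Y <<= E *m E -> Y <<= E.
Proof.
move=> hY Epsd YE; have hE := psd_herm Epsd.
have hD : (E - Y)^t* = E - Y by rewrite trmxCB hE hY.
have [U [d [UU DE _]]] := hermitian_spectral hD.
have UU' := adj_unitary UU.
rewrite /loewner_le DE; apply: psd_congr; apply: psd_dmx => i.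
rewrite leNgt; apply/negP => di.
pose v := U^t* *m delta_mx i (0 : 'I_1).
have Dv : (E - Y) *m v = (d i)%:C *: v.
  by rewrite DE /v !mulmxA -(mulmxA _ U) UU' mulmx1 -mulmxA dmx_delta scalemxAr.
have v1 : normsq v = 1.
  by rewrite /normsq -qf_congr trmxCK mulmx1 UU' qf_delta mxE eqxx.
have Yv : Y *m v = E *m v + (- d i)%:C *: v.
  by rewrite rmorphN scaleNr -Dv mulmxBl opprB addrCA subrr addr0.
have := loewner_qf v YE.
have sqE (M : 'M[R[i]]_n) : M^t* = M -> qf (M *m M) v = normsq (M *m v).
  by move=> hM; rewrite -qf_trmxCM hM.
rewrite (sqE _ hY) (sqE _ hE) Yv /normsq (qfDx _ _ (trmxC1 _)).
rewrite sformZr /qf sformZl sformZr -!/(qf _ _) -/(normsq v) v1.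
rewrite sform_mull mulmx1 hE -/(sform E v v) -/(qf E v).
have : 0 <= qf E v by case/psdP: Epsd.
move: (qf E v) (qf 1%:M (E *m v)) (d i) di => p q c c0 p0.
have := mulr_le0_ge0 (ltW c0) p0; have : 0 < c * c by rewrite nmulr_rgt0.
lra.
Qed.

(** In coordinates where [A = 1] and [B] is diagonal, block positivity says
    [Y ^ 2 <= B] for the transported [X], and the geometric mean is the square root
    of [B]. *)
Lemma block_psd_geomean A X B : pdmx A -> pdmx B -> X^t* = X ->
  block_psd A X B -> X <<= geomean 2^-1 A B.
Proof.
move=> Apd Bpd hX; have [S [d [Su d0 -> ->]]] := pd_gram Apd Bpd.
rewrite (geomean_gram _ Su d0) => AXB.
have [E [EdE EE Epsd]] : exists E : 'M[R[i]]_n,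
    [/\ dmx (fun i => d i `^ 2^-1) = E, E *m E = dmx d & psdmx E].
  exists (dmx (fun i => d i `^ 2^-1)); split; first by [].
    by rewrite mul_dmx; apply: eq_dmx => i; rewrite powR_half.
  by apply: psd_dmx => i; rewrite powR_ge0.
have [Z SZ] : exists Z, S *m Z = 1%:M by exists (invmx S); rewrite mulmxV.
have ZS : Z *m S = 1%:M by exact: mulmx1C.
have ZS' : S^t* *m Z^t* = 1%:M by rewrite -trmxCM ZS trmxC1.
have [Y YE [hY XE]] : exists2 Y, Z^t* *m X *m Z = Y & Y^t* = Y /\ X = S^t* *m Y *m S.
  exists (Z^t* *m X *m Z); first by [].
  split; first by rewrite !trmxCM trmxCK hX mulmxA.
  by rewrite !mulmxA ZS' mul1mx -mulmxA ZS mulmx1.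
have hYY : (Y *m Y)^t* = Y *m Y by rewrite trmxCM hY.
rewrite EdE XE; apply: loewner_congr; apply: (psd_sqr_le hY Epsd).
rewrite EE; apply/(loewnerP hYY (trmxC_dmx d)) => v.
have := AXB (Z *m (- (Y *m v))) (Z *m v).
rewrite -sform_mulm YE sformNl sform_mull hY -/(sform (Y *m Y) v v).
rewrite -/(qf (Y *m Y) v) (qf_congr S (dmx _)) (qf_congr S) !(mulmxA S) SZ.
rewrite !mul1mx dmx1.
have -> : qf 1%:M (- (Y *m v)) = qf (Y *m Y) v.
  by rewrite /qf sformNl sformNr opprK -[LHS]/(normsq _) -qf_trmxCM hY.
by move: (qf (Y *m Y) v) (qf (dmx d) v) => p q; lra.
Qed.

End BlockPositivity.

(** Writing a diagonalised matrix as a combination of positive rank one matrices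
    gives linear maps that are merely positive something to act on. *)
Lemma gram_sum n (S : 'M[R[i]]_n) (d : 'I_n -> R) :
  S^t* *m dmx d *m S = \sum_i (d i)%:C *: ((row i S)^t* *m row i S).
Proof.
apply/matrixP => j k; rewrite summxE mul_mx_diag mxE; apply: eq_bigr => i _.
by rewrite !mxE big_ord1 !mxE /=; ring.
Qed.

Section PositiveMaps.
Variables (n m : nat) (Phi : {linear 'M[R[i]]_n -> 'M[R[i]]_m}).
Hypothesis Phi_pos : positive_map Phi.

Lemma map_loewner A B : A <<= B -> Phi A <<= Phi B.
Proof. by move=> /Phi_pos; rewrite linearB. Qed.

Lemma map_herm_pd A : pdmx A -> (Phi A)^t* = Phi A.
Proof. by move=> /pd_psd/Phi_pos/psd_herm. Qed.

Lemma psd_gram (S : 'M[R[i]]_n) i : psdmx ((row i S)^t* *m row i S).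
Proof.
have := @psd_congr R n 1 (row i S) 1%:M; rewrite mulmx1; apply.
exact/pd_psd/pdmx1.
Qed.

Lemma map_gram_sum (S : 'M[R[i]]_n) (d : 'I_n -> R) :
  Phi (S^t* *m dmx d *m S) =
  \sum_i (d i)%:C *: Phi ((row i S)^t* *m row i S).
Proof.
by rewrite gram_sum linear_sum; apply: eq_bigr => i _; rewrite linearZ.
Qed.

(** Along a simultaneous diagonalisation the map only meets rank one matrices,
    where the block form is a sum of values of quadratic forms at
    [a i x + b i y]. *)
Lemma map_block_psd (S : 'M[R[i]]_n) (a b p q r : 'I_n -> R) :
  (forall i, p i = a i * a i) -> (forall i, q i = a i * b i) ->
  (forall i, r i = b i * b i) ->
  block_psd (Phi (S^t* *m dmx p *m S)) (Phi (S^t* *m dmx q *m S))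
            (Phi (S^t* *m dmx r *m S)).
Proof.
move=> pE qE rE x y.
rewrite (map_gram_sum S p) (map_gram_sum S q) (map_gram_sum S r) /qf.
rewrite !sform_summ mulr_sumr -big_split -big_split.
apply: sumr_ge0 => i _; rewrite !sform_scalem /= pE qE rE.
have /psdP[hQ /(_ ((a i)%:C *: x + (b i)%:C *: y))] := Phi_pos (psd_gram S i).
rewrite (qfDx _ _ hQ) /qf !(sformZl, sformZr).
move: (sform _ x x) (sform _ x y) (sform _ y y) => u v w.
by congr (_ <= _); ring.
Qed.

(** The geometric mean makes the block with diagonal [A], [B] positive; the map
    preserves this block, and the mean of [A'] and [B'] dominates its off-diagonal
    entry. *)
Lemma map_geomean_half A B A' B' : pdmx A -> pdmx B -> pdmx A' -> pdmx B' ->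
  Phi A <<= A' -> Phi B <<= B' -> Phi (geomean 2^-1 A B) <<= geomean 2^-1 A' B'.
Proof.
move=> Apd Bpd Apd' Bpd' AA BB.
apply: block_psd_geomean => //; first exact/map_herm_pd/pd_geomean.
apply: block_psd_le AA BB _.
have [S [d [Su d0 -> ->]]] := pd_gram Apd Bpd.
rewrite (geomean_gram _ Su d0).
apply: (map_block_psd _ (a := fun=> 1) (b := fun i => d i `^ 2^-1)) => i.
- by rewrite mulr1.
- by rewrite mul1r.
- by rewrite powR_half.
Qed.

Lemma continuous_qf_geomean A B x : pdmx A -> pdmx B ->
  continuous (fun t => qf (Phi (geomean t A B)) x).
Proof.
move=> Apd Bpd; have [S [d [Su d0 -> ->]]] := pd_gram Apd Bpd.
pose Q i := qf (Phi ((row i S)^t* *m row i S)) x.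
rewrite [X in continuous X](_ : _ = fun t => \sum_i expR (t * ln (d i)) * Q i).
  apply: continuous_big => [|i _ t]; first exact: add_continuous.
  apply: cvgM; last exact: cvg_cst.
  apply: continuous_comp; last exact: continuous_expR.
  by apply: cvgM; [exact: cvg_id | exact: cvg_cst].
apply/funext => t; rewrite (geomean_gram _ Su d0) map_gram_sum /qf sform_summ.
by apply: eq_bigr => i _; rewrite sform_scalem /powR gt_eqF.
Qed.

End PositiveMaps.

(** Ando's inequality, with monotonicity of the mean built in: at a
    midpoint of two exponents, the means already obtained for them are only upper
    bounds of images, so the inequality for [1/2] is applied with such bounds. *)
Theorem map_geomean n m (Phi : {linear 'M[R[i]]_n -> 'M[R[i]]_m}) t A B A' B' :
  positive_map Phi -> 0 <= t <= 1 ->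
  pdmx A -> pdmx B -> pdmx A' -> pdmx B' ->
  Phi A <<= A' -> Phi B <<= B' -> Phi (geomean t A B) <<= geomean t A' B'.
Proof.
move=> Phi_pos t01 Apd Bpd Apd' Bpd' AA BB.
pose h x t := qf (geomean t A' B') x - qf (Phi (geomean t A B)) x.
have hP s : Phi (geomean s A B) <<= geomean s A' B' <-> forall x, 0 <= h x s.
  rewrite loewnerP; last 2 first.
  - exact/(map_herm_pd Phi_pos)/pd_geomean.
  - exact/pd_herm/pd_geomean.
  by split=> H x; have := H x; rewrite /h subr_ge0.
apply/hP; pose S := \bigcap_x [set s | 0 <= h x s].
suff : S t by move=> St x; apply: St.
apply: closed_midpoint_itv t01.
- apply: closed_bigI => x _; apply: (@preimage_closed _ _ (h x) [set y | 0 <= y]).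
    move=> s _; apply: cvgB.
      exact: (@continuous_qf_geomean _ _ idfun _ _ x Apd' Bpd').
    exact: continuous_qf_geomean.
  exact: closed_ge.
- move=> x _; apply: (hP 0).1.
  by rewrite (geomean_t0 Apd Bpd) (geomean_t0 Apd' Bpd'); exact: AA.
- move=> x _; apply: (hP 1).1.
  by rewrite (geomean_t1 Apd Bpd) (geomean_t1 Apd' Bpd'); exact: BB.
- move=> r s r01 s01 Sr Ss x _; apply: (hP _).1 => {x}.
  rewrite -(geomean_mid _ _ Apd Bpd) -(geomean_mid _ _ Apd' Bpd').
  apply: (map_geomean_half Phi_pos (pd_geomean r Apd Bpd)
    (pd_geomean s Apd Bpd) (pd_geomean r Apd' Bpd') (pd_geomean s Apd' Bpd')).
    by apply: (hP r).2 => x; apply: Sr.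
  by apply: (hP s).2 => x; apply: Ss.
Qed.

(** Monotonicity is the case of the identity map. *)
Lemma geomean_le n t (A B A' B' : 'M[R[i]]_n) : 0 <= t <= 1 ->
  pdmx A -> pdmx B -> pdmx A' -> pdmx B' ->
  A <<= A' -> B <<= B' -> geomean t A B <<= geomean t A' B'.
Proof. exact: (@map_geomean n n idfun). Qed.

Section UnitalPositiveMaps.
Variables (n m : nat) (Phi : {linear 'M[R[i]]_n -> 'M[R[i]]_m}).
Hypotheses (Phi_pos : positive_map Phi) (Phi1 : unital_map Phi).

Lemma map_pd A : pdmx A -> pdmx (Phi A).
Proof.
move=> /pd_lower_bound[e e0 /(map_loewner Phi_pos)].
by rewrite linearZ Phi1; apply: pd_loewner; apply: pdZ e0 _; apply: pdmx1.
Qed.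

Lemma invmx_cancel n' (P K : 'M[R[i]]_n') : P \in unitmx ->
  invmx P *m (P *m K *m P) *m invmx P = K.
Proof. by move=> Pu; rewrite mulmxA mulmxK // mulmxA mulVmx // mul1mx. Qed.

Lemma gram_sandwich n' (S T D : 'M[R[i]]_n') : S \in unitmx -> T \in unitmx ->
  (T *m D *m S) *m invmx (T *m S) *m (T *m D *m S) = T *m (D *m D) *m S.
Proof.
move=> Su Tu; have -> : invmx (T *m S) = invmx S *m invmx T.
  apply: (can_inj (mulKmx (_ : T *m S \in unitmx))); rewrite ?unitmx_mul ?Tu //.
  by rewrite mulmxV ?unitmx_mul ?Tu // mulmxA mulmxK // mulmxV.
by rewrite !mulmxA mulmxK // mulmxKV.
Qed.

(** The affine upper bound at [X] of the concave map [A |-> Phi (A^-1)^-1]. *)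
Lemma map_inv_supporting X A (Y := invmx (Phi (invmx X))) :
  pdmx X -> pdmx A ->
  invmx (Phi (invmx A)) <<= Y *m Phi (invmx X *m A *m invmx X) *m Y.
Proof.
move=> Xpd Apd.
have Cpd := pdmx_inv Apd; have Bpd := pdmx_inv Xpd.
have PCpd := map_pd Cpd; have PBpd := map_pd Bpd.
have Yh : Y^t* = Y by apply/pd_herm/pdmx_inv.
suff : Phi (invmx X) *m invmx (Phi (invmx A)) *m Phi (invmx X) <<=
       Phi (invmx X *m A *m invmx X).
  move=> /(loewner_congr Y); rewrite Yh /Y.
  by rewrite (invmx_cancel _ (pdmx_unit PBpd)).
have hB := pd_herm Bpd.
apply: block_psd_schur (PCpd) (pd_herm PBpd) _ _.
  apply/psd_herm/Phi_pos; rewrite -{1}hB.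
  exact/psd_congr/pd_psd.
have [S [d [Su d0 CE BE]]] := pd_gram Cpd Bpd.
have -> : invmx X *m A *m invmx X = S^t* *m dmx (fun i => d i * d i) *m S.
  have Su' : S^t* \in unitmx by rewrite unitmx_trmxC.
  rewrite -[A]invmxK CE BE dmx1 mulmx1 (gram_sandwich _ Su Su').
  by rewrite mul_dmx.
rewrite CE BE; apply: (map_block_psd Phi_pos _ (a := fun=> 1) (b := d)) => i.
- by rewrite mulr1.
- by rewrite mul1r.
- by [].
Qed.

End UnitalPositiveMaps.

End BlockForms.

(** * Norm and topology of the space of matrices *)

Section MatrixNorm.
Context {R : realType} {n : nat}.
Implicit Types (M N : 'M[R[i]]_n) (z : R[i]).

(** The norm of a matrix takes real values in a complex field; comparison with real
    and imaginary parts reduces estimates to real numbers. *)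
Lemma norm_ge_ReIm z : `|ReC z| <= ReC `|z| /\ `|ImC z| <= ReC `|z|.
Proof.
rewrite normc_def /=; split; rewrite -[leLHS]sqrtr_sqr ler_wsqrtr //.
  by rewrite lerDl sqr_ge0.
by rewrite lerDr sqr_ge0.
Qed.

Lemma norm_le_ReIm z : ReC `|z| <= `|ReC z| + `|ImC z|.
Proof.
rewrite normc_def /=; have h : 0 <= `|ReC z| + `|ImC z| by rewrite addr_ge0.
rewrite -[leRHS](ger0_norm h) -sqrtr_sqr ler_wsqrtr // sqrrD.
rewrite !real_normK ?num_real // lerD // lerDl mulrn_wge0 // mulr_ge0 //.
Qed.

Lemma mxnorm_real M : `|M| = (ReC `|M|)%:C.
Proof. by apply: complexP => //=; apply: ger0_Im. Qed.

Lemma entry_le_mxnorm M i j :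
  `|ReC (M i j)| <= ReC `|M| /\ `|ImC (M i j)| <= ReC `|M|.
Proof.
have : `|M i j| <= `|M|.
  rewrite [leRHS]/Num.norm /= mx_normE -[leLHS]nngE num_le.
  exact: (le_bigmax _ (fun ij : 'I_n * 'I_n => `|M ij.1 ij.2|%:nng) (i, j)).
have [? ?] := norm_ge_ReIm (M i j).
by rewrite lecE => /andP[_ h]; split; exact: le_trans h.
Qed.

Lemma mxnorm_le M (b : R) : 0 <= b ->
  (forall i j, `|ReC (M i j)| <= b /\ `|ImC (M i j)| <= b) ->
  ReC `|M| <= 2 * b.
Proof.
move=> b0 Mb; rewrite [Num.norm M]/Num.norm /=.
have [->|] := eqVneq (mx_norm M) 0; first by rewrite /= mulr_ge0.
move=> /mx_norm_neq0[[i j] ->] /=; apply: le_trans (norm_le_ReIm _) _.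
by have [? ?] := Mb i j; rewrite mulrC mulr_natr mulr2n lerD.
Qed.

(** Boxes in the real and imaginary parts of the entries form a basis of
    neighbourhoods, which replaces the complex valued norm in topological
    arguments. *)
Lemma nbhs_mx_box M (U : set 'M[R[i]]_n) : nbhs M U <->
  exists2 e : R, 0 < e & forall N,
    (forall i j, `|ReC (N i j - M i j)| < e /\ `|ImC (N i j - M i j)| < e) -> U N.
Proof.
split.
  move=> /nbhs_normP[[e e'] /=]; rewrite ltcE /= => /andP[/eqP -> e0] MU.
  (* The norm is at most twice the largest real or imaginary part. *)
  exists (e / 3); first by rewrite divr_gt0.
  move=> N MN; apply: MU => /=; rewrite mxnorm_real ltcR.
  apply: (@le_lt_trans _ _ (2 * (e / 3))); last by lra.
  apply: mxnorm_le => [|i j]; first by rewrite divr_ge0 // ltW.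
  have [h1 h2] := MN i j.
  have -> : (M - N) i j = - (N i j - M i j) by rewrite !mxE opprB.
  by rewrite ReN ImN !normrN; split; apply: ltW.
move=> [e e0 MU]; have [_] := nbhs_normP M U; apply.
exists e%:C; first by rewrite /= ltcR.
move=> N /=; rewrite mxnorm_real ltcR => MN; apply: MU => i j.
have [] := entry_le_mxnorm (M - N) i j.
have -> : (M - N) i j = - (N i j - M i j) by rewrite !mxE opprB.
rewrite ReN ImN !normrN => h1 h2.
by split; [apply: le_lt_trans h1 MN | apply: le_lt_trans h2 MN].
Qed.

Lemma continuous_Re_entry i j : continuous (fun M => ReC (M i j)).
Proof.
move=> M U /nbhs_ballP[e /= e0 MU]; apply/nbhs_mx_box; exists e => // N MN.
by apply: MU; rewrite /ball /= distrC -ReB; case: (MN i j).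
Qed.

Lemma continuous_Im_entry i j : continuous (fun M => ImC (M i j)).
Proof.
move=> M U /nbhs_ballP[e /= e0 MU]; apply/nbhs_mx_box; exists e => // N MN.
by apply: MU; rewrite /ball /= distrC -ImB; case: (MN i j).
Qed.

End MatrixNorm.

(** * Integrals of bounded functions *)

Section BoundedIntegral.
Context {d : measure_display} {T : measurableType d} {R : realType}.
Variables (mu : {measure set T -> \bar R}) (E : set T).
Hypotheses (mu_fin : (mu setT < +oo)%E) (mE : measurable E) (muE : mu (~` E) = 0%E).
Implicit Types f g : T -> R.

(** Boundedness is asked for only on [E], a set of full measure: the integrands of
    interest are bounded on the order interval that carries the measure, and
    unbounded elsewhere. *)
Definition bounded_on f : Prop :=
  measurable_fun setT f /\ exists M, forall x, E x -> `|f x| <= M.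

Lemma bounded_on_integrable f : bounded_on f -> mu.-integrable setT (EFin \o f).
Proof.
move=> [mf [M fM]]; have mEC := measurableC mE.
apply/(negligible_integrable mEC measurableT _ muE); first exact/measurable_EFinP.
rewrite setTD setCK; apply: measurable_bounded_integrable => //.
- by apply: le_lt_trans mu_fin; apply: le_measure; rewrite ?inE.
- exact: measurable_funS mf.
- exists M; split; first exact: num_real.
  by move=> y My x Ex; apply: le_trans (fM x Ex) (ltW My).
Qed.

Lemma bounded_on_integral f : bounded_on f ->
  (\int[mu]_x f x = \int[mu]_(x in E) f x)%R.
Proof.
move=> bf; rewrite /Rintegral; congr fine.
rewrite (negligible_integral (measurableC mE) measurableT _ muE) ?setTD ?setCK //.
exact: bounded_on_integrable.
Qed.

Lemma bounded_on_le f g : bounded_on f -> bounded_on g ->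
  (forall x, E x -> f x <= g x) -> \int[mu]_x f x <= \int[mu]_x g x.
Proof.
move=> bf bg fg; rewrite !bounded_on_integral //; apply: le_Rintegral => //.
  by apply: (integrableS measurableT) => //; exact: bounded_on_integrable.
by apply: (integrableS measurableT) => //; exact: bounded_on_integrable.
Qed.

Lemma bounded_onZ f c : bounded_on f -> bounded_on (fun x => c * f x).
Proof.
move=> [mf [M fM]]; split; first exact: measurable_funM.
exists (`|c| * M) => x Ex; rewrite normrM ler_wpM2l //; exact: fM.
Qed.

Lemma bounded_onD f g : bounded_on f -> bounded_on g ->
  bounded_on (fun x => f x + g x).
Proof.
move=> [mf [M fM]] [mg [N gN]]; split; first exact: measurable_funD.
exists (M + N) => x Ex; apply: le_trans (ler_normD _ _) _.
by rewrite lerD //; [exact: fM | exact: gN].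
Qed.

Lemma bounded_on_sum (I : Type) (s : seq I) (f : I -> T -> R) :
  (forall i, bounded_on (f i)) -> bounded_on (fun x => \sum_(i <- s) f i x).
Proof.
move=> bf; elim: s => [|i s IH].
  split; first by under eq_fun do rewrite big_nil; exact: measurable_cst.
  by exists 0 => x _; rewrite big_nil normr0.
rewrite (_ : (fun x => _) = fun x => f i x + \sum_(j <- s) f j x).
  exact: bounded_onD.
by apply/funext => x; rewrite big_cons.
Qed.

Lemma bounded_on_Rint_sum (I : Type) (s : seq I) (f : I -> T -> R) :
  (forall i, bounded_on (f i)) ->
  (\int[mu]_x (\sum_(i <- s) f i x) = \sum_(i <- s) \int[mu]_x f i x)%R.
Proof.
move=> bf; elim: s => [|i s IH].
  by under eq_Rintegral do rewrite big_nil; rewrite big_nil Rintegral_cst // mul0r.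
rewrite big_cons -IH; under eq_Rintegral do rewrite big_cons.
apply: RintegralD => //; apply: bounded_on_integrable => //.
exact: bounded_on_sum.
Qed.

Lemma bounded_on_RintZ f c : bounded_on f ->
  (\int[mu]_x (c * f x) = c * \int[mu]_x f x)%R.
Proof. by move=> bf; apply: RintegralZl => //; exact: bounded_on_integrable. Qed.

End BoundedIntegral.

(** * Entrywise integrals of matrix functions *)

Section RealLinear.
Context {R : realType} {n : nat}.
Variable l : 'M[R[i]]_n -> R.
Hypotheses (lD : forall A B, l (A + B) = l A + l B)
           (lZ : forall (a : R) A, l (a%:C *: A) = a * l A).

Lemma real_linear_sum (I : Type) (s : seq I) (F : I -> 'M[R[i]]_n) :
  l (\sum_(k <- s) F k) = \sum_(k <- s) l (F k).
Proof.
apply: (big_morph l) => //.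
by rewrite -(scale0r (0 : 'M[R[i]]_n)) (lZ 0) mul0r.
Qed.

(** Every real linear functional is a combination of the real and imaginary parts of
    the entries, so that it commutes with the entrywise integral.  This covers
    quadratic forms and the entries of the image under a linear map alike. *)
Lemma real_linear_entries M :
  l M = \sum_(p : 'I_n * 'I_n)
    (ReC (M p.1 p.2) * l (delta_mx p.1 p.2) +
     ImC (M p.1 p.2) * l ('i *: delta_mx p.1 p.2)).
Proof.
rewrite {1}[M]matrix_sum_delta pair_bigA real_linear_sum.
apply: eq_bigr => -[i j] _ /=; rewrite -!lZ -lD; congr l.
by rewrite scalerA -scalerDl {1}[M i j]complexE mulrC.
Qed.

End RealLinear.

Section MatrixIntegral.
Context {d : measure_display} {T : measurableType d} {R : realType} {n : nat}.
Variables (mu : {measure set T -> \bar R}) (E : set T).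
Hypotheses (mu_fin : (mu setT < +oo)%E) (mE : measurable E)
  (muE : mu (~` E) = 0%E).
Implicit Types f g : T -> 'M[R[i]]_n.

Definition mxint f : 'M[R[i]]_n :=
  \matrix_(i, j) ((\int[mu]_x ReC (f x i j)) +i* (\int[mu]_x ImC (f x i j)))%R.

Definition mxbounded_on f : Prop := forall i j,
  bounded_on E (fun x => ReC (f x i j)) /\ bounded_on E (fun x => ImC (f x i j)).

Section RealLinearIntegral.
Variable l : 'M[R[i]]_n -> R.
Hypotheses (lD : forall A B, l (A + B) = l A + l B)
           (lZ : forall (a : R) A, l (a%:C *: A) = a * l A).

Let term f (p : 'I_n * 'I_n) x :=
  ReC (f x p.1 p.2) * l (delta_mx p.1 p.2) +
  ImC (f x p.1 p.2) * l ('i *: delta_mx p.1 p.2).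

Lemma real_linear_term f p : mxbounded_on f -> bounded_on E (term f p).
Proof.
move=> bf; have [bR bI] := bf p.1 p.2; rewrite /term.
under eq_fun do rewrite mulrC [X in _ + X]mulrC.
by apply: bounded_onD; apply: bounded_onZ.
Qed.

Lemma real_linear_bounded_on f : mxbounded_on f ->
  bounded_on E (fun x => l (f x)).
Proof.
move=> bf; under eq_fun do rewrite (real_linear_entries lD lZ).
by apply: bounded_on_sum => p; apply: real_linear_term.
Qed.

Lemma real_linear_mxint f : mxbounded_on f ->
  l (mxint f) = (\int[mu]_x l (f x))%R.
Proof.
move=> bf; rewrite (real_linear_entries lD lZ).
under eq_Rintegral do rewrite (real_linear_entries lD lZ).
rewrite (bounded_on_Rint_sum mu_fin mE muE); last first.
  by move=> p; apply: real_linear_term.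
apply: eq_bigr => p _; have [bR bI] := bf p.1 p.2.
rewrite !mxE /= mulrC [X in _ + X]mulrC.
rewrite -!(bounded_on_RintZ mu_fin mE muE) // -RintegralD //.
- by apply: eq_Rintegral => x _; rewrite mulrC [X in _ + X]mulrC.
- by apply: (bounded_on_integrable mu_fin mE muE); apply: bounded_onZ.
- by apply: (bounded_on_integrable mu_fin mE muE); apply: bounded_onZ.
Qed.

End RealLinearIntegral.

Lemma qf_mxint f v : mxbounded_on f -> qf (mxint f) v = (\int[mu]_x qf (f x) v)%R.
Proof.
by apply: (real_linear_mxint (l := fun A => qf A v)) => *;
  rewrite ?qfD ?qfZ.
Qed.

Lemma qf_bounded_on f v : mxbounded_on f -> bounded_on E (fun x => qf (f x) v).
Proof.
by apply: (real_linear_bounded_on (l := fun A => qf A v)) => *;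
  rewrite ?qfD ?qfZ.
Qed.

Lemma herm_mxint f : mxbounded_on f -> (forall x, (f x)^t* = f x) ->
  (mxint f)^t* = mxint f.
Proof.
move=> bf hf; have fji x i j : f x j i = (f x i j)^*%C.
  by rewrite -{1}(hf x) !mxE.
apply/matrixP => i j; rewrite !mxE /=; apply: complexP => /=.
  by apply: eq_Rintegral => x _; rewrite fji; case: (f x i j).
have [_ bI] := bf i j.
rewrite -[RHS]opprK; congr (- _).
rewrite -mulN1r -(bounded_on_RintZ mu_fin mE muE) //.
by apply: eq_Rintegral => x _; rewrite fji mulN1r; case: (f x i j).
Qed.

(** The order is tested on quadratic forms, which commute with the integral. *)
Lemma le_mxint f g : mxbounded_on f -> mxbounded_on g ->
  (forall x, (f x)^t* = f x) -> (forall x, (g x)^t* = g x) ->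
  (forall x, E x -> f x <<= g x) -> mxint f <<= mxint g.
Proof.
move=> bf bg hf hg fg.
apply/(loewnerP (herm_mxint bf hf) (herm_mxint bg hg)) => v.
rewrite (qf_mxint v bf) (qf_mxint v bg); apply: (bounded_on_le mu_fin mE muE).
- exact: qf_bounded_on.
- exact: qf_bounded_on.
- by move=> x Ex; apply: loewner_qf; apply: fg.
Qed.

Lemma mxint_cst (A : 'M[R[i]]_n) : mu setT = 1%E -> mxint (fun=> A) = A.
Proof.
move=> mu1; apply/matrixP => i j; rewrite mxE.
by rewrite !Rintegral_cst // mu1 /= !mulr1; case: (A i j).
Qed.

End MatrixIntegral.

Section LinearImage.
Context {d : measure_display} {T : measurableType d} {R : realType} {n m : nat}.
Variables (mu : {measure set T -> \bar R}) (E : set T).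
Hypotheses (mu_fin : (mu setT < +oo)%E) (mE : measurable E)
  (muE : mu (~` E) = 0%E).
Variables (Phi : 'M[R[i]]_n -> 'M[R[i]]_m) (f : T -> 'M[R[i]]_n).
Hypotheses (PhiD : forall A B, Phi (A + B) = Phi A + Phi B)
  (PhiZ : forall (a : R) A, Phi (a%:C *: A) = a%:C *: Phi A).
Hypothesis bf : mxbounded_on E f.

Let ReD' i j A B : ReC (Phi (A + B) i j) = ReC (Phi A i j) + ReC (Phi B i j).
Proof. by rewrite PhiD mxE ReD. Qed.
Let ImD' i j A B : ImC (Phi (A + B) i j) = ImC (Phi A i j) + ImC (Phi B i j).
Proof. by rewrite PhiD mxE ImD. Qed.
Let ReZ' i j (a : R) A : ReC (Phi (a%:C *: A) i j) = a * ReC (Phi A i j).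
Proof. by rewrite PhiZ mxE Re_realM. Qed.
Let ImZ' i j (a : R) A : ImC (Phi (a%:C *: A) i j) = a * ImC (Phi A i j).
Proof. by rewrite PhiZ mxE Im_realM. Qed.

Lemma mxbounded_on_linear : mxbounded_on E (Phi \o f).
Proof.
move=> i j; split.
  exact: (real_linear_bounded_on (ReD' i j) (ReZ' i j) bf).
exact: (real_linear_bounded_on (ImD' i j) (ImZ' i j) bf).
Qed.

Lemma linear_mxint : Phi (mxint mu f) = mxint mu (Phi \o f).
Proof.
apply/matrixP => i j; rewrite mxE; apply: complexP => /=.
  exact: (real_linear_mxint mu_fin mE muE (ReD' i j) (ReZ' i j) bf).
exact: (real_linear_mxint mu_fin mE muE (ImD' i j) (ImZ' i j) bf).
Qed.

End LinearImage.

(** * Borel and simple matrix functions *)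

Section Borel.
Context {d : measure_display} {T : measurableType d} {R : realType} {n : nat}.
Implicit Types f s : T -> 'M[R[i]]_n.

Definition borel_mx f : Prop :=
  forall U : set 'M[R[i]]_n, open U -> measurable (f @^-1` U).

Lemma measurable_open_preimages (g : T -> R) :
  (forall a b, measurable (g @^-1` `]a, b[%classic)) -> measurable_fun setT g.
Proof.
move=> mg; apply: (measurability _ (RGenOpens.measurableE R)).
by move=> _ [_ [a [b ->] <-]]; rewrite setTI; apply: mg.
Qed.

Lemma borel_comp f (h : 'M[R[i]]_n -> R) : borel_mx f -> continuous h ->
  measurable_fun setT (h \o f).
Proof.
move=> bf /continuousP ch; apply: measurable_open_preimages => a b.
by rewrite comp_preimage; apply: bf; apply: ch; apply: interval_open.
Qed.

Definition simple_mx s : Prop :=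
  finite_set (range s) /\ forall v, measurable (s @^-1` [set v]).

(** The preimage is a finite union of level sets, which need not come from open
    sets of matrices. *)
Lemma simple_measurable_comp s (h : 'M[R[i]]_n -> R) : simple_mx s ->
  measurable_fun setT (h \o s).
Proof.
move=> [fs ms] _ Y mY; rewrite setTI.
have -> : (h \o s) @^-1` Y = \bigcup_(v in range s `&` h @^-1` Y) s @^-1` [set v].
  apply/seteqP; split => [x hx | x [v [_ hv] /= sx]].
    by exists (s x) => //; split => //; exists x.
  by rewrite /= sx.
by apply: fin_bigcup_measurable => // ; apply: finite_setIl.
Qed.

Lemma continuous_mxdist (v : 'M[R[i]]_n) : continuous (fun M : 'M[R[i]]_n => ReC `|M - v|).
Proof.
move=> M U /nbhs_ballP[e /= e0 MU].
apply/nbhs_mx_box; exists (e / 4); first by rewrite divr_gt0.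
move=> N MN; apply: MU; rewrite /ball /=.
have triangle (A B : 'M[R[i]]_n) : ReC `|A| <= ReC `|B| + ReC `|A - B|.
  rewrite -lecR rmorphD /= -!mxnorm_real.
  by apply: le_trans (ler_normD _ _); rewrite subrKC.
have MN4 : ReC `|M - N| < e.
  apply: (@le_lt_trans _ _ (2 * (e / 4))); last by lra.
  apply: mxnorm_le => [|i j]; first by rewrite divr_ge0 // ltW.
  have -> : (M - N) i j = - (N i j - M i j) by rewrite !mxE opprB.
  by have [h1 h2] := MN i j; rewrite ReN ImN !normrN; split; apply: ltW.
have := triangle (M - v) (N - v); have := triangle (N - v) (M - v).
have -> : N - v - (M - v) = - (M - N) by rewrite !opprB addrA subrK.
have -> : M - v - (N - v) = M - N by rewrite opprB addrA subrK.
rewrite normrN ltr_norml; move: MN4.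
move: (ReC `|M - N|) (ReC `|M - v|) (ReC `|N - v|) => p q r; lra.
Qed.

(** On each of the finitely many level sets of [s], the distance is a continuous
    function of [f] alone; measurability of pairs of matrix functions is avoided. *)
Lemma measurable_dist f s : borel_mx f -> simple_mx s ->
  measurable_fun setT (fun x => ReC `|f x - s x|).
Proof.
move=> bf [fs ms]; apply: measurable_open_preimages => a b.
set Y := `]a, b[%classic.
have -> : (fun x => ReC `|f x - s x|) @^-1` Y =
    \bigcup_(v in range s)
      (s @^-1` [set v] `&` f @^-1` [set M | Y (ReC `|M - v|)]).
  apply/seteqP; split => [x hx | x [v _ [/= -> //]]].
  by exists (s x).
apply: fin_bigcup_measurable => // v _; apply: measurableI; first exact: ms.
apply: bf; have /continuousP cd := @continuous_mxdist v.
by apply: (cd Y); apply: interval_open.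
Qed.

End Borel.

Section Bochner.
Context {d : measure_display} {T : measurableType d} {R : realType} {n : nat}.
Variables (mu : {measure set T -> \bar R}) (E : set T).
Hypotheses (mu_fin : (mu setT < +oo)%E) (mE : measurable E)
  (muE : mu (~` E) = 0%E).
Implicit Types f s : T -> 'M[R[i]]_n.

Lemma simple_bounded_on s : simple_mx s -> mxbounded_on E s.
Proof.
move=> [fs ms] i j.
have bnd (h : 'M[R[i]]_n -> R) : exists M, forall x, E x -> `|h (s x)| <= M.
  exists (\sum_(v <- fset_set (range s)) `|h v|) => x _.
  have sx : s x \in fset_set (range s) by rewrite in_fset_set // inE; exists x.
  by rewrite (big_fsetD1 (s x)) //= lerDl sumr_ge0.
split; split; first exact: (@simple_measurable_comp _ _ _ _ s (fun M => ReC (M i j))).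
- exact: (bnd (fun M => ReC (M i j))).
- exact: (@simple_measurable_comp _ _ _ _ s (fun M => ImC (M i j))).
- exact: (bnd (fun M => ImC (M i j))).
Qed.

(** A function of a simple function is a finite combination of indicators. *)
Lemma integral_simple s (h : 'M[R[i]]_n -> R) : simple_mx s ->
  (\int[mu]_x h (s x))%R =
  \sum_(v <- fset_set (range s)) fine (mu (s @^-1` [set v])) * h v.
Proof.
move=> ss; have [fs ms] := ss.
have b1 v : bounded_on E (\1_(s @^-1` [set v]) : T -> R).
  split; first exact: measurable_indic.
  by exists 1 => x _; rewrite indicE; case: (_ \in _); rewrite ?normr1 ?normr0.
have hE x : h (s x) =
    \sum_(v <- fset_set (range s)) h v * \1_(s @^-1` [set v]) x.
  have sx : s x \in fset_set (range s) by rewrite in_fset_set // inE; exists x.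
  rewrite (big_fsetD1 (s x)) //= indicE mem_set // mulr1 big1_fset ?addr0 //.
  move=> v; rewrite !inE => /andP[vs _] _; rewrite indicE memNset ?mulr0 //=.
  by move=> sv; rewrite sv eqxx in vs.
under eq_Rintegral do rewrite hE.
rewrite (bounded_on_Rint_sum mu_fin mE muE) => [|v]; last exact: bounded_onZ.
apply: eq_bigr => v _; rewrite (bounded_on_RintZ mu_fin mE muE) // mulrC.
by rewrite /Rintegral integral_indic // setIT.
Qed.

Lemma simple_integralE s : simple_mx s -> simple_integral mu s = mxint mu s.
Proof.
move=> ss; have [fs ms] := ss; rewrite /simple_integral fsbig_finite //.
apply/matrixP => i j; rewrite summxE mxE.
rewrite (integral_simple (fun M => ReC (M i j)) ss).
rewrite (integral_simple (fun M => ImC (M i j)) ss).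
apply: complexP => /=; rewrite ?Re_sum ?Im_sum; apply: eq_bigr => v _.
  by rewrite mxE Re_realM.
by rewrite mxE Im_realM.
Qed.

Lemma simple_integrable s : simple_mx s <-> integrable_simple mu s.
Proof.
split=> [[fs ms]|[fs ms _]]; last by split.
by split=> // v _; apply: le_lt_trans mu_fin; apply: le_measure; rewrite ?inE.
Qed.

(** The [L^1] distance of [f] and [s] controls every entry of the difference of
    their integrals. *)
Lemma mxint_dist f s : borel_mx f -> mxbounded_on E f -> simple_mx s ->
  forall i j, let D := (\int[mu]_x (ReC `|f x - s x|)%:E)%E in
  (`|ReC (mxint mu f i j - mxint mu s i j)|%:E <= D)%E /\
  (`|ImC (mxint mu f i j - mxint mu s i j)|%:E <= D)%E.
Proof.
move=> Bf bf ss i j D; have bs := simple_bounded_on ss.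
have mD := measurable_dist Bf ss.
have key (g h : T -> R) : bounded_on E g -> bounded_on E h ->
    (forall x, `|g x - h x| <= ReC `|f x - s x|) ->
    (`|(\int[mu]_x g x - \int[mu]_x h x)%R|%:E <= D)%E.
  move=> bg bh ghD; have ig := bounded_on_integrable mu_fin mE muE bg.
  have ih := bounded_on_integrable mu_fin mE muE bh.
  have igh : mu.-integrable setT (EFin \o (fun x => g x - h x)).
    by have := integrableB measurableT ig ih.
  rewrite -RintegralB //.
  have -> : (`|(\int[mu]_x (g x - h x))%R|%:E =
             `|\int[mu]_x (g x - h x)%:E|)%E.
    by rewrite /Rintegral -abse_EFin fineK //; apply: integrable_fin_num.
  apply: (le_trans (le_abse_integral _ measurableT _)).
    by case/integrableP: igh.
  apply: ge0_le_integral => //.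
  - by apply: measurableT_comp => //; case/integrableP: igh.
  - exact/measurable_EFinP.
  - by move=> x _; rewrite lee_fin; apply: ghD.
have [bfR bfI] := bf i j; have [bsR bsI] := bs i j.
rewrite ReB ImB !mxE /=; split; apply: key => // x.
  by have [] := entry_le_mxnorm (f x - s x) i j; rewrite !mxE ReB.
by have [_] := entry_le_mxnorm (f x - s x) i j; rewrite !mxE ImB.
Qed.

End Bochner.

(** * The Bochner integral of a bounded function *)

Section SimpleApproximation.
Context {d : measure_display} {T : measurableType d} {R : realType} {n : nat}.
Variable E : set T.
Implicit Types f : T -> 'M[R[i]]_n.

Lemma mxbounded_uniform f : mxbounded_on E f ->
  exists M, forall x, E x -> forall i j,
    `|ReC (f x i j)| <= M /\ `|ImC (f x i j)| <= M.
Proof.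
move=> bf.
have /choice[M MP] : forall p : 'I_n * 'I_n, exists M, forall x, E x ->
    `|ReC (f x p.1 p.2)| <= M /\ `|ImC (f x p.1 p.2)| <= M.
  move=> [i j]; have [[_ [M1 h1]] [_ [M2 h2]]] := bf i j.
  exists (Num.max M1 M2) => x Ex.
  by rewrite !le_max (h1 x Ex) (h2 x Ex) orbT.
exists (\sum_p `|M p|) => x Ex i j.
have le_sum : M (i, j) <= \sum_p `|M p|.
  by rewrite (bigD1 (i, j)) //= ler_wpDr ?sumr_ge0 ?ler_norm.
by have [h1 h2] := MP (i, j) x Ex; split; apply: le_trans le_sum.
Qed.

(** The truncated floor is monotone, hence Borel. *)
Lemma measurable_truncn_level (g : T -> R) (N l : nat) :
  measurable_fun setT g ->
  measurable [set x | minn (Num.truncn (g x)) N = l].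
Proof.
move=> mg; pose q (r : R) : R := (minn (Num.truncn r) N)%:R.
have mq : measurable_fun setT q.
  apply: nondecreasing_measurable => // r s rs; rewrite ler_nat.
  by rewrite leq_min geq_minr andbT geq_min le_truncn.
have := measurableT_comp mq mg measurableT (measurable_set1 l%:R).
rewrite setTI; congr measurable; apply/seteqP; split => x /=.
  by move=> /eqP; rewrite eqr_nat => /eqP.
by rewrite /q => ->.
Qed.

(** Each real and imaginary part is rounded down to the grid of step [1 / K] on
    [[- M, M]]; the level sets are preimages of finitely many grid points.  The
    cut-off [N] keeps the range finite also outside [E]. *)
Lemma simple_approximation f (K : R) : borel_mx f -> mxbounded_on E f -> 0 < K ->
  exists2 s : T -> 'M[R[i]]_n, simple_mx s &
    forall x, E x -> ReC `|f x - s x| <= 2 * K^-1.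
Proof.
move=> Bf /mxbounded_uniform[M fM] K0.
pose N := Num.truncn (2 * K * M).
pose q (r : R) : nat := minn (Num.truncn (K * (r + M))) N.
pose v (l : nat) : R := l%:R / K - M.
have qv r : `|r| <= M -> `|r - v (q r)| <= K^-1.
  rewrite ler_norml => /andP[Mr rM]; pose y := K * (r + M).
  have y0 : 0 <= y by apply: mulr_ge0; [exact: ltW | lra].
  have -> : q r = Num.truncn y.
    apply/minn_idPl/le_truncn; rewrite -mulrA mulrCA; apply: ler_wpM2l.
      exact: ltW.
    by rewrite mulr_natl mulr2n lerD2r.
  have /andP[ty yt] := truncn_itv y0.
  have -> : r - v (Num.truncn y) = (y - (Num.truncn y)%:R) / K.
    by rewrite /v /y mulrBl mulrAC mulfV ?gt_eqF // mul1r opprB addrA addrAC.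
  rewrite ger0_norm; last by rewrite divr_ge0 ?subr_ge0 // ltW.
  by rewrite ler_pdivrMr // mulVf ?gt_eqF // lerBlDl natr1 ltW.
(* The numbers of the grid cells, in a finite type. *)
pose code x : 'M['I_N.+1 * 'I_N.+1]_n :=
  \matrix_(i, j) (inord (q (ReC (f x i j))), inord (q (ImC (f x i j)))).
pose H (c : 'M['I_N.+1 * 'I_N.+1]_n) : 'M[R[i]]_n :=
  \matrix_(i, j) (v (c i j).1 +i* v (c i j).2).
have qN r : (q r < N.+1)%N by rewrite ltnS geq_minr.
have mcode c : measurable (code @^-1` [set c]).
  have -> : code @^-1` [set c] = \bigcap_(p in [set: 'I_n * 'I_n])
      ([set x | q (ReC (f x p.1 p.2)) = (c p.1 p.2).1] `&`
       [set x | q (ImC (f x p.1 p.2)) = (c p.1 p.2).2]).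
    apply/seteqP; split => [x /= <- p _ | x cx].
      by rewrite !mxE /=; split; rewrite inordK.
    apply/matrixP => i j; rewrite mxE; have [/= h1 h2] := cx (i, j) I.
    by rewrite h1 h2 !inord_val; case: (c i j).
  apply: fin_bigcap_measurable; first exact: finite_finset.
  move=> [i j] _ /=; apply: measurableI; apply: measurable_truncn_level.
    apply: measurable_funM => //; apply: measurable_funD => //.
    exact: (borel_comp Bf (@continuous_Re_entry R n i j)).
  apply: measurable_funM => //; apply: measurable_funD => //.
  exact: (borel_comp Bf (@continuous_Im_entry R n i j)).
exists (H \o code); first split.
- apply: (@sub_finite_set _ _ (H @` setT)); first by move=> _ [x _ <-]; exists (code x).
  by apply: finite_image; exact: finite_finset.
- move=> w; have -> : (H \o code) @^-1` [set w] =
      \bigcup_(c in [set c | H c = w]) code @^-1` [set c].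
    apply/seteqP; split => [x hx | x [c hc /= xc]]; first by exists (code x).
    by rewrite /= xc.
  by apply: fin_bigcup_measurable => //; exact: finite_finset.
- move=> x Ex; apply: mxnorm_le => [|i j]; first by rewrite invr_ge0 ltW.
  rewrite !mxE ReB ImB /= !inordK //.
  by have [h1 h2] := fM x Ex i j; split; apply: qv.
Qed.

End SimpleApproximation.

Section BochnerIntegral.
Context {d : measure_display} {T : measurableType d} {R : realType} {n : nat}.
Variables (mu : {measure set T -> \bar R}) (E : set T).
Hypotheses (mu_fin : (mu setT < +oo)%E) (mE : measurable E)
  (muE : mu (~` E) = 0%E).
Implicit Types f s : T -> 'M[R[i]]_n.

Lemma mxnorm_ge0 (A : 'M[R[i]]_n) : 0 <= ReC `|A|.
Proof. by have := normr_ge0 A; rewrite lecE => /andP[]. Qed.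

Lemma near_lt_ereal (u : nat -> \bar R) (e : R) : 0 < e ->
  u k @[k --> \oo] --> 0%E -> \forall k \near \oo, (u k < e%:E)%E.
Proof.
move=> e0 u0; apply: (u0 [set y | (y < e%:E)%E]); apply: open_nbhs_nbhs.
by split; [exact: open_ereal_lt_ereal | rewrite /= lte_fin].
Qed.

(** Simple integrals are entrywise integrals, and the entrywise integral is
    continuous for the [L^1] distance, so the limit [v] has the entries of
    [mxint mu f]. *)
Lemma bochner_integral_eq f (v : 'M[R[i]]_n) : mxbounded_on E f ->
  has_bochner_integral mu f v -> v = mxint mu f.
Proof.
move=> bf [Bf [s [ss Dlim Slim]]].
have ss' k : simple_mx (s k) by apply/(simple_integrable mu_fin).
have close e : 0 < e -> forall i j,
    `|ReC (v i j - mxint mu f i j)| < e /\ `|ImC (v i j - mxint mu f i j)| < e.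
  move=> e0 i j; have e20 : 0 < e / 2 by rewrite divr_gt0.
  have box : nbhs v [set N | forall i j, `|ReC (N i j - v i j)| < e / 2 /\
      `|ImC (N i j - v i j)| < e / 2].
    by apply/nbhs_mx_box; exists (e / 2).
  have near_v : \forall k \near \oo, forall i j,
      `|ReC (simple_integral mu (s k) i j - v i j)| < e / 2 /\
      `|ImC (simple_integral mu (s k) i j - v i j)| < e / 2 := Slim _ box.
  have near_D := near_lt_ereal e20 Dlim.
  have [k [/= kv kD]] := filter_ex (filterI near_v near_D).
  have [dR dI] := mxint_dist mu_fin mE muE Bf bf (ss' k) i j.
  have {dR} := le_lt_trans dR kD; have {dI} := le_lt_trans dI kD.
  have [] := kv i j; rewrite (simple_integralE mu_fin mE muE (ss' k)).
  rewrite !lte_fin !(ReB, ImB) !ltr_norml.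
  by move=> /andP[? ?] /andP[? ?] /andP[? ?] /andP[? ?]; split; lra.
apply/matrixP => i j; apply: complexP; apply/eqP; rewrite -subr_eq0 -?ReB -?ImB;
  apply/negPn/negP; rewrite -normr_gt0 => /close/(_ i j)[]; rewrite ltxx //.
Qed.

(** Rounding to the grid of step [1 / (k + 1)] gives simple functions whose [L^1]
    distance to [f] is [O (1 / k)]. *)
Lemma has_bochner_integral_mxint f : borel_mx f -> mxbounded_on E f ->
  has_bochner_integral mu f (mxint mu f).
Proof.
move=> Bf bf; split; first exact: Bf.
have /choice[s sP] : forall k : nat, exists s, simple_mx s /\
    forall x, E x -> ReC `|f x - s x| <= 2 * (k.+1%:R)^-1.
  by move=> k; have [s ? ?] := simple_approximation Bf bf (ltr0Sn R k); exists s.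
have ss k : simple_mx (s k) by have [] := sP k.
have Dlim : (\int[mu]_x (ReC `|f x - s k x|)%:E)%E @[k --> \oo] --> 0%E.
  have D0 k : (0 <= \int[mu]_x (ReC `|f x - s k x|)%:E)%E.
    by apply: integral_ge0 => x _; rewrite lee_fin mxnorm_ge0.
  pose c := 2 * fine (mu setT).
  apply: (@squeeze_cvge _ _ _ _ (cst 0%E) _ (fun k => (c * k.+1%:R^-1)%:E)).
  - apply: nearW => k; rewrite D0 /=.
    have -> : ((c * k.+1%:R^-1)%:E = (2 * k.+1%:R^-1)%:E * mu setT)%E.
      rewrite -[mu setT]fineK ?ge0_fin_numE // -EFinM.
      by rewrite /c mulrAC.
    have mD := measurable_dist Bf (ss k).
    have := @integral_le_bound _ _ _ mu setT
      (fun x => (ReC `|f x - s k x|)%:E) (2 * k.+1%:R^-1)%:E measurableT.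
    under eq_integral do rewrite gee0_abs ?lee_fin ?mxnorm_ge0 //.
    apply; first exact/measurable_EFinP.
      by rewrite lee_fin mulr_ge0.
    exists (~` E); split=> //; first exact: measurableC.
    move=> x /= nx Ex; apply: nx => _.
    by rewrite lee_fin ger0_norm ?mxnorm_ge0 //; apply: (sP k).2.
  - exact: cvg_cst.
  - apply/fine_cvgP; split; first exact: nearW.
    rewrite -[X in _ --> X](mulr0 c); apply: cvgM; first exact: cvg_cst.
    exact: cvg_harmonic.
exists s; split=> //; first by move=> k; apply/(simple_integrable mu_fin).
move=> U /nbhs_mx_box[e e0 eU]; have := near_lt_ereal e0 Dlim.
apply: filterS => k kD; apply: eU => i j.
have [dR dI] := mxint_dist mu_fin mE muE Bf bf (ss k) i j.
have {dR} := le_lt_trans dR kD; have {dI} := le_lt_trans dI kD.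
rewrite (simple_integralE mu_fin mE muE (ss k)) !lte_fin.
by rewrite -[_ - mxint mu f i j]opprB ReN ImN !normrN.
Qed.

End BochnerIntegral.

(** * Matrix entries against the order *)

Section OrderBounds.
Context {R : realType} {n : nat}.
Implicit Types (A B D : 'M[R[i]]_n) (x y : 'cV[R[i]]_n).

Lemma qf_scalar (b : R) x : qf (b%:C *: 1%:M) x = b * normsq x.
Proof. exact: qfZ. Qed.

Lemma pd_qf_ge0 A x : pdmx A -> 0 <= qf A x.
Proof. by move=> /pd_psd/psdP[_]; apply. Qed.

Lemma herm_scalar (b : R) : (b%:C *: (1%:M : 'M[R[i]]_n))^t* = b%:C *: 1%:M.
Proof. by rewrite trmxCZ trmxC1. Qed.

Lemma sform_polar D x y : D^t* = D ->
  4 * sform D x y = qf D (x + y) - qf D (x - y).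
Proof.
move=> hD; have qN : qf D (- y) = qf D y by rewrite /qf sformNl sformNr opprK.
rewrite !(qfDx _ _ hD) qN sformNr.
by move: (qf D x) (sform D x y) (qf D y) => u v w; ring.
Qed.

(** Polarisation and the parallelogram law: the bound [b] passes from the quadratic to
    the bilinear form without loss. *)
Lemma sform_le D (b : R) x y : D^t* = D ->
  (forall z, `|qf D z| <= b * normsq z) ->
  normsq x = 1 -> normsq y = 1 -> `|sform D x y| <= b.
Proof.
move=> hD Db x1 y1.
have : normsq (x + y) + normsq (x - y) = 4.
  have yN : normsq (- y) = 1 by rewrite -y1 /normsq /qf sformNl sformNr opprK.
  have := qfDx x y (trmxC1 n); have := qfDx x (- y) (trmxC1 n).
  rewrite -!/(normsq _) sformNr x1 y1 yN => -> ->.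
  by move: (sform _ x y) => u; ring.
have := Db (x + y); have := Db (x - y); have := sform_polar x y hD.
rewrite !ler_norml => e /andP[h1 h2] /andP[h3 h4] s.
move: e h1 h2 h3 h4 s; rewrite -(ler_pM2l (_ : 0 < 4 :> R)) //.
move: (qf D _) (qf D _) (normsq _) (normsq _) (sform D x y) => p q r s u e h1 h2 h3 h4 rs.
have e4 : b * r + b * s = 4 * b by rewrite -mulrDr rs mulrC.
by apply/andP; split; lra.
Qed.

Lemma normsq_delta i : normsq (delta_mx i 0 : 'cV[R[i]]_n) = 1.
Proof. by rewrite /normsq qf_delta mxE eqxx. Qed.

Lemma sform_delta D i j : sform D (delta_mx i 0) (delta_mx j 0) = ReC (D i j).
Proof.
rewrite /sform; congr complex.Re.
by rewrite trmx_delta map_delta_mx -rowE -colE !mxE.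
Qed.

(** Multiplying one basis vector by [i] turns the imaginary part of an entry into a
    value of the real form. *)
Lemma sform_idelta D i j :
  sform D (delta_mx i 0) ('i *: delta_mx j 0) = - ImC (D i j).
Proof.
rewrite /sform trmx_delta map_delta_mx -rowE -scalemxAr -colE !mxE.
by rewrite mulrC; case: (D i j) => *; rewrite /= mulr0 mulr1 sub0r.
Qed.

Lemma normsq_idelta i : normsq ('i *: delta_mx i 0 : 'cV[R[i]]_n) = 1.
Proof.
rewrite normsqE (bigD1 i) //= big1 => [|j ji]; last first.
  by rewrite !mxE (negbTE ji) mulr0 /csq /= expr0n addr0.
by rewrite !mxE eqxx mulr1 /csq /= expr0n expr1n add0r addr0.
Qed.

(** The entries are values of the bilinear form at unit vectors, so a bound on
    quadratic forms bounds them. *)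
Lemma entry_le_qf D (b : R) i j : D^t* = D ->
  (forall z, `|qf D z| <= b * normsq z) ->
  `|ReC (D i j)| <= b /\ `|ImC (D i j)| <= b.
Proof.
move=> hD Db; split.
  by rewrite -sform_delta; apply: sform_le => //; apply: normsq_delta.
rewrite -normrN -sform_idelta; apply: sform_le => //; first exact: normsq_delta.
exact: normsq_idelta.
Qed.

Lemma herm_qf_eq0 D : D^t* = D -> (forall z, qf D z = 0) -> D = 0.
Proof.
move=> hD D0; apply/matrixP => i j; rewrite mxE.
have [] := @entry_le_qf D 0 i j hD; first by move=> z; rewrite D0 normr0 mul0r.
by rewrite !normr_le0 => /eqP h1 /eqP h2; apply: complexP.
Qed.

Lemma loewner_anti A B : A^t* = A -> B^t* = B -> A <<= B -> B <<= A -> A = B.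
Proof.
move=> hA hB AB BA; apply/eqP; rewrite -subr_eq0; apply/eqP/herm_qf_eq0.
  by rewrite trmxCB hA hB.
move=> z; apply/eqP; rewrite qfB subr_eq0 eq_le.
by rewrite (loewner_qf z AB) (loewner_qf z BA).
Qed.

(** Crude in the dimension, but it makes entrywise smallness imply smallness in the
    order. *)
Lemma qf_le_entries D (e : R) :
  (forall i j, `|ReC (D i j)| <= e /\ `|ImC (D i j)| <= e) ->
  forall z, `|qf D z| <= 2 * n%:R * e * normsq z.
Proof.
move=> De z.
have -> : qf D z = \sum_i \sum_j ReC ((z i 0)^*%C * D i j * z j 0).
  rewrite /qf /sform mxE Re_sum exchange_big /=; apply: eq_bigr => j _.
  rewrite mxE mulr_suml Re_sum; apply: eq_bigr => i _.
  by rewrite !mxE.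
have term i j : `|ReC ((z i 0)^*%C * D i j * z j 0)| <=
    e * csq (z i 0) + e * csq (z j 0).
  have [] := De i j; rewrite /csq.
  case: (z i 0) (z j 0) (D i j) => [a b] [c d] [p q] /= pe qe.
  have bnd u : - (a ^+ 2 + b ^+ 2 + (c ^+ 2 + d ^+ 2)) <= 2 * u ->
      2 * u <= a ^+ 2 + b ^+ 2 + (c ^+ 2 + d ^+ 2) ->
      `|u| <= (a ^+ 2 + b ^+ 2 + (c ^+ 2 + d ^+ 2)) / 2.
    by move=> h1 h2; rewrite ler_norml; apply/andP; split; lra.
  have u1 : `|a * c + b * d| <= (a ^+ 2 + b ^+ 2 + (c ^+ 2 + d ^+ 2)) / 2.
    by apply: bnd; [have := sqr_ge0 (a + c); have := sqr_ge0 (b + d)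
      | have := sqr_ge0 (a - c); have := sqr_ge0 (b - d)]; lra.
  have u2 : `|a * d - b * c| <= (a ^+ 2 + b ^+ 2 + (c ^+ 2 + d ^+ 2)) / 2.
    by apply: bnd; [have := sqr_ge0 (a + d); have := sqr_ge0 (b - c)
      | have := sqr_ge0 (a - d); have := sqr_ge0 (b + c)]; lra.
  have -> : (a * p - - b * q) * c - (a * q + - b * p) * d =
      p * (a * c + b * d) - q * (a * d - b * c) by ring.
  apply: le_trans (ler_normB _ _) _; rewrite !normrM.
  have h1 := ler_pM (normr_ge0 _) (normr_ge0 _) pe u1.
  have h2 := ler_pM (normr_ge0 _) (normr_ge0 _) qe u2.
  by apply: le_trans (lerD h1 h2) _; lra.
apply: le_trans (ler_norm_sum _ _ _) _.
apply: (@le_trans _ _ (\sum_i \sum_j (e * csq (z i 0) + e * csq (z j 0)))).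
  apply: ler_sum => i _; apply: le_trans (ler_norm_sum _ _ _) _.
  by apply: ler_sum => j _; apply: term.
have -> : \sum_(i < n) \sum_(j < n) (e * csq (z i 0) + e * csq (z j 0)) =
    2 * n%:R * e * normsq z.
  under eq_bigr do rewrite big_split /= sumr_const card_ord -mulr_sumr -normsqE.
  rewrite big_split /= sumr_const card_ord sumrMnl -mulr_sumr -normsqE.
  by rewrite -[e * normsq z *+ n]mulr_natr; ring.
by [].
Qed.

Lemma herm_upper_bound A : A^t* = A -> exists2 b : R, 0 < b & A <<= b%:C *: 1%:M.
Proof.
move=> hA; pose e := \sum_i \sum_j (`|ReC (A i j)| + `|ImC (A i j)|).
have e0 : 0 <= e by apply: sumr_ge0 => i _; apply: sumr_ge0 => j _; apply: addr_ge0.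
exists (2 * n%:R * e + 1).
  by rewrite ltr_wpDl // !mulr_ge0.
apply/(loewnerP hA (herm_scalar _)) => z; rewrite qf_scalar.
have Ae i j : `|ReC (A i j)| <= e /\ `|ImC (A i j)| <= e.
  have : `|ReC (A i j)| + `|ImC (A i j)| <= e.
    rewrite /e (bigD1 i) //= (bigD1 j) //= -addrA lerDl addr_ge0 //.
      by apply: sumr_ge0 => k _; apply: addr_ge0.
    by apply: sumr_ge0 => k _; apply: sumr_ge0 => l _; apply: addr_ge0.
  move=> h; split; apply: le_trans h; first by rewrite lerDl.
  by rewrite lerDr.
apply: le_trans (ler_norm _) _; apply: le_trans (qf_le_entries Ae z) _.
by rewrite ler_wpM2r ?normsq_ge0 // lerDl.
Qed.

(** The block with diagonal [A], [A^-1] and off-diagonal blocks [1] is positive;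
    enlarging [A] to [B] keeps it so, and its Schur complement is the claim. *)
Lemma loewner_inv A B : pdmx A -> pdmx B -> A <<= B -> invmx B <<= invmx A.
Proof.
move=> Apd Bpd AB; have := @block_psd_schur R n B 1%:M (invmx A) Bpd (trmxC1 n).
rewrite mul1mx mulmx1; apply; first exact/pd_herm/pdmx_inv.
have : block_psd A 1%:M (invmx A); last first.
  exact: block_psd_le AB (loewner_refl _).
move=> x y; have /psdP[hA /(_ (x + invmx A *m y))] := pd_psd Apd.
rewrite (qfDx _ _ hA); congr (0 <= _ + 2 * _ + _).
  by rewrite /sform !mulmxA mulmx1 mulmxK // pdmx_unit.
by rewrite -qf_congr trmxCV hA mulVmx ?mul1mx // pdmx_unit.
Qed.

End OrderBounds.

(** * Topology of the positive definite matrices *)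

Section PDTopology.
Context {R : realType} {n : nat}.
Implicit Types Z W : PD R n.

Lemma PD_herm Z : (PD_val Z)^t* = PD_val Z.
Proof. exact/pd_herm/PD_valP. Qed.

Lemma continuous_PD_val : continuous (@PD_val R n).
Proof. exact: initial_continuous. Qed.

Lemma open_PD (U : set (PD R n)) : open U ->
  exists2 V : set 'M[R[i]]_n, open V & @PD_val R n @^-1` V = U.
Proof. by move=> [V oV VU]; exists V. Qed.

Lemma nbhs_PD_box Z (U : set (PD R n)) : nbhs Z U <->
  exists2 e : R, 0 < e & forall W,
    (forall i j, `|ReC (PD_val W i j - PD_val Z i j)| < e /\
                 `|ImC (PD_val W i j - PD_val Z i j)| < e) -> U W.
Proof.
split=> [|[e e0 ZU]].
  rewrite nbhsE => -[B [oB BZ] BU]; have [V oV VB] := open_PD oB.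
  have /nbhs_mx_box[e e0 ZV] : nbhs (PD_val Z) V.
    by apply: open_nbhs_nbhs; split; [| move: BZ; rewrite -VB].
  by exists e => // W WZ; apply: BU; rewrite -VB; apply: ZV.
pose B := [set N : 'M[R[i]]_n | forall i j,
    `|ReC (N i j - PD_val Z i j)| < e /\ `|ImC (N i j - PD_val Z i j)| < e].
have box : nbhs (PD_val Z) B by apply/nbhs_mx_box; exists e.
have ZB : nbhs Z (@PD_val R n @^-1` B) := continuous_PD_val box.
by apply: filterS ZB => W; exact: ZU.
Qed.

Lemma measurable_open_PD (U : set (PD R n)) : open U -> measurable U.
Proof. by move=> oU; apply: sub_sigma_algebra. Qed.

Lemma measurable_closed_PD (U : set (PD R n)) : closed U -> measurable U.
Proof.
move=> cU; rewrite -[U]setCK; apply: measurableC; apply: measurable_open_PD.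
exact: closed_openC.
Qed.

Lemma continuous_borel p (f : PD R n -> 'M[R[i]]_p) : continuous f -> borel_mx f.
Proof.
by move=> /continuousP cf U oU; apply: measurable_open_PD; apply: cf.
Qed.

(** Matrices that are close to [Z] are close relative to [Z], because [Z] is bounded
    below by a positive multiple of the identity. *)
Lemma nbhs_relative_order Z (c : R) : 1 < c ->
  \forall W \near Z, PD_val W <<= c%:C *: PD_val Z /\ PD_val Z <<= c%:C *: PD_val W.
Proof.
move=> c1; have c0 : 0 < c by apply: lt_trans c1.
have [e e0 eZ] := pd_lower_bound (PD_valP Z).
(* If [W - Z] lies between [- k Z] and [k Z], then [W <= (1 + k) Z <= c Z] and
   [c^-1 Z = (1 - k) Z <= W]. *)
pose k := 1 - c^-1.
have k0 : 0 < k by rewrite subr_gt0 invf_lt1.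
have kc : 1 + k <= c.
  have : 0 <= (c - 1) ^+ 2 / c by rewrite divr_ge0 ?sqr_ge0 // ltW.
  have -> : (c - 1) ^+ 2 / c = c - 1 - k by rewrite /k; field; rewrite gt_eqF.
  by lra.
(* A box of radius [de] gives forms of size [2 n de <= k e]; the summand [1] only
   avoids dividing by zero when [n = 0]. *)
pose de := k * e / (2 * n%:R + 1).
have n0 : 0 < 2 * n%:R + 1 :> R by rewrite ltr_wpDl // mulr_ge0.
have de0 : 0 < de by rewrite divr_gt0 // mulr_gt0.
apply/nbhs_PD_box; exists de; first exact: de0.
move=> W WZ.
have dZ z : `|qf (PD_val W - PD_val Z) z| <= k * qf (PD_val Z) z.
  apply: (@le_trans _ _ (2 * n%:R * de * normsq z)).
    apply: qf_le_entries => i j; have [h1 h2] := WZ i j.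
    by rewrite !mxE; split; apply: ltW.
  apply: (@le_trans _ _ (k * e * normsq z)).
    rewrite ler_wpM2r ?normsq_ge0 // /de mulrA ler_pdivrMr // mulrC.
    by rewrite ler_wpM2l ?lerDl // mulr_ge0 ?ltW.
  rewrite -mulrA; apply: ler_wpM2l; first exact: ltW.
  by rewrite -qf_scalar; apply: loewner_qf.
have hW := PD_herm W; have hZ := PD_herm Z.
split; apply/loewnerP => [||z]; rewrite ?trmxCZ ?hW ?hZ // qfZ.
  have := dZ z; rewrite qfB ler_norml => /andP[_].
  have q0 := pd_qf_ge0 z (PD_valP Z).
  have := ler_wpM2r q0 kc.
  by move: (qf _ z) (qf _ z) => u v; lra.
have := dZ z; rewrite qfB ler_norml => /andP[+ _].
move: (qf _ z) (qf _ z) => u v h.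
have : c^-1 * v <= u by move: h; rewrite /k; lra.
by rewrite ler_pdivrMl.
Qed.

(** The Thompson metric at work: a map with positive definite values that respects
    the relations [Z <= c W <= c ^ 2 Z] sends relative order intervals into relative
    order intervals, which shrink to a point as [c] tends to [1]. *)
Lemma relative_order_continuous p (f : PD R n -> 'M[R[i]]_p) :
  (forall Z, pdmx (f Z)) ->
  (forall (c : R) Z W, 1 <= c -> PD_val Z <<= c%:C *: PD_val W ->
     PD_val W <<= c%:C *: PD_val Z -> f Z <<= c%:C *: f W) ->
  continuous f.
Proof.
move=> fpd fle Z U /nbhs_mx_box[e e0 eU].
have [q q0 fq] := herm_upper_bound (pd_herm (fpd Z)).
(* So that [(c - 1) f Z <= (e / 2) I]. *)
pose c := 1 + e / (2 * q).
have c1 : 1 < c by rewrite ltrDl divr_gt0 // mulr_gt0.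
have := nbhs_relative_order Z c1; apply: filterS => W [WZ ZW].
have h1 := fle _ _ _ (ltW c1) WZ ZW; have h2 := fle _ _ _ (ltW c1) ZW WZ.
apply: eU => i j.
have [] := @entry_le_qf R p (f W - f Z) (e / 2) i j.
- by rewrite trmxCB !pd_herm.
- move=> z; rewrite qfB.
  have := loewner_qf z h1; have := loewner_qf z h2; have := loewner_qf z fq.
  rewrite !qfZ -/(normsq z).
  have W0 := pd_qf_ge0 z (fpd W).
  have Z0 := pd_qf_ge0 z (fpd Z).
  have z0 := normsq_ge0 z.
  have cq : (c - 1) * q = e / 2.
    by rewrite /c addrAC subrr add0r; field; rewrite gt_eqF.
  move: (qf (f W) z) (qf (f Z) z) (normsq z) W0 Z0 z0 => w y s w0 y0 s0 ys yw wy.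
  have ey : (c - 1) * y <= e / 2 * s.
    by rewrite -cq -mulrA ler_wpM2l // subr_ge0 ltW.
  have [yw'|wy'] := leP y w.
    by rewrite ger0_norm ?subr_ge0 //; lra.
  have : (c - 1) * w <= (c - 1) * y by apply: ler_wpM2l; [rewrite subr_ge0|]; apply: ltW.
  by rewrite ler0_norm; [lra | rewrite subr_le0; apply: ltW].
rewrite !mxE => h3 h4; have e2 : e / 2 < e by lra.
by split; [apply: le_lt_trans h3 e2 | apply: le_lt_trans h4 e2].
Qed.

(** If [Z <= c W] then [X #_t Z <= X #_t c W = c ^ t (X #_t W)]. *)
Lemma continuous_geomean t (X : 'M[R[i]]_n) : 0 <= t <= 1 -> pdmx X ->
  continuous (fun Z : PD R n => geomean t X (PD_val Z)).
Proof.
move=> t01 Xpd; apply: relative_order_continuous => [Z|c Z W c1 ZW _].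
  exact: pd_geomean Xpd (PD_valP Z).
have c0 : 0 < c by apply: lt_le_trans c1.
have Wpd := PD_valP W; have Zpd := PD_valP Z; have cWpd := pdZ c0 Wpd.
apply: (loewner_trans (geomean_le t01 Xpd Zpd Xpd cWpd (loewner_refl _) ZW)).
have := geomean_scale t ltr01 c0 Xpd Wpd; rewrite scale1r powR1 mul1r => ->.
apply: loewner_scale; last exact: pd_psd (pd_geomean t Xpd Wpd).
have [_ t1] := andP t01; have := ler_powR c1 t1.
by rewrite powRr1 // ltW.
Qed.

Lemma continuous_PD_inv : continuous (fun Z : PD R n => PD_val (PD_inv Z)).
Proof.
apply: relative_order_continuous => [Z|c Z W c1 _ WZ]; first exact: PD_valP.
have c0 : 0 < c by apply: lt_le_trans c1.
have Wpd := PD_valP W; have Zpd := PD_valP Z.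
have := loewner_inv Wpd (pdZ c0 Zpd) WZ => /(loewnerZ (ltW c0)).
have c0' : c%:C != 0 by rewrite eq_complex /= gt_eqF.
by rewrite (invmxZ (pdmx_unit (pdZ c0 Zpd))) scalerA (mulfV c0') scale1r.
Qed.

(** The open sets of the subspace topology generate the Borel sets, and come from
    open sets of matrices. *)
Lemma measurable_to_PD (d : measure_display) (T : measurableType d)
    (G : T -> PD R n) : borel_mx (fun x => PD_val (G x)) -> measurable_fun setT G.
Proof.
move=> bG; apply: (@measurability _ _ _ _ _ _ (@open (PD R n))) => //.
move=> _ [U oU <-]; rewrite setTI; have [V oV <-] := open_PD oU.
by rewrite -comp_preimage; apply: bG.
Qed.

Definition order_itv (a b : R) : set (PD R n) :=
  [set Z | a%:C *: 1%:M <<= PD_val Z /\ PD_val Z <<= b%:C *: 1%:M].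

Lemma continuous_qf_PD z : continuous (fun Z : PD R n => qf (PD_val Z) z).
Proof.
move=> Z U /nbhs_ballP[e /= e0 eU].
pose k := 2 * n%:R * normsq z + 1.
have k0 : 0 < k by rewrite ltr_wpDl // !mulr_ge0 ?normsq_ge0.
apply/nbhs_PD_box; exists (e / k); first by rewrite divr_gt0.
move=> W WZ; apply: eU; rewrite /ball /= distrC -qfB.
have De i j : `|ReC ((PD_val W - PD_val Z) i j)| <= e / k /\
    `|ImC ((PD_val W - PD_val Z) i j)| <= e / k.
  by have [h1 h2] := WZ i j; rewrite !mxE; split; apply: ltW.
apply: le_lt_trans (qf_le_entries De z) _.
rewrite mulrAC mulrA ltr_pdivrMr // mulrC ltr_pM2l //.
by rewrite /k ltrDl.
Qed.

Lemma measurable_order_itv a b : measurable (order_itv a b).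
Proof.
have -> : order_itv a b = (\bigcap_z [set Z | a * normsq z <= qf (PD_val Z) z]) `&`
    (\bigcap_z [set Z | qf (PD_val Z) z <= b * normsq z]).
  apply/seteqP; split => Z.
    by move=> [h1 h2]; split=> z _ /=; rewrite -qf_scalar; apply: loewner_qf.
  move=> [h1 h2]; split.
    apply/(loewnerP (herm_scalar _) (PD_herm Z)) => z; rewrite qf_scalar.
    exact: h1.
  apply/(loewnerP (PD_herm Z) (herm_scalar _)) => z; rewrite qf_scalar.
  exact: h2.
apply: measurableI; apply: measurable_closed_PD; apply: closed_bigI => z _.
  apply: (@preimage_closed _ _ (fun Z => qf (PD_val Z) z)
    [set y | a * normsq z <= y]); last exact: closed_ge.
  by move=> Z _; apply: continuous_qf_PD.
apply: (@preimage_closed _ _ (fun Z => qf (PD_val Z) z)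
  [set y | y <= b * normsq z]); last exact: closed_le.
by move=> Z _; apply: continuous_qf_PD.
Qed.

End PDTopology.

(** * Measures of compact support *)

Section Support.
Context {R : realType} {n : nat}.
Variable mu : {measure set (PD R n) -> \bar R}.

Let code : countType := ('M[rat * rat]_n * nat)%type.

(** The countable basis of neighbourhoods with rational centres and radii
    [1 / (k + 1)]. *)
Definition rational_box (c : code) : set (PD R n) :=
  [set Z | forall i j, `|ReC (PD_val Z i j) - ratr (c.1 i j).1| < c.2.+1%:R^-1 /\
                       `|ImC (PD_val Z i j) - ratr (c.1 i j).2| < c.2.+1%:R^-1].

Lemma open_rational_box c : open (rational_box c).
Proof.
rewrite openE => Z Zc; rewrite /interior.
pose f (p : 'I_n * 'I_n) := [set W : PD R n |
    `|ReC (PD_val W p.1 p.2) - ratr (c.1 p.1 p.2).1| < c.2.+1%:R^-1 /\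
    `|ImC (PD_val W p.1 p.2) - ratr (c.1 p.1 p.2).2| < c.2.+1%:R^-1].
have : \forall W \near Z, forall p, f p W.
  have FZ : Filter (nbhs Z) by exact: nbhs_filter.
  apply: (@filter_forall _ _ f (nbhs Z) FZ) => -[i j]; rewrite /f; have [h1 h2] := Zc i j.
  apply/nbhs_PD_box; move: h1 h2 => /=.
  move: (ratr _) (ratr _) (_^-1) => q2 q1 r h1 h2.
  exists (Num.min (r - `|ReC (PD_val Z i j) - q1|) (r - `|ImC (PD_val Z i j) - q2|)).
    by rewrite lt_min !subr_gt0 h1.
  move=> W /(_ i j)[]; rewrite !lt_min !(ReB, ImB) => /andP[w1 _] /andP[_ w2].
  split.
    rewrite -(subrKA (ReC (PD_val Z i j))); apply: le_lt_trans (ler_normD _ _) _.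
    by rewrite -ltrBrDr.
  rewrite -(subrKA (ImC (PD_val Z i j))); apply: le_lt_trans (ler_normD _ _) _.
  by rewrite -ltrBrDr.
by apply: filterS => W H i j; apply: (H (i, j)).
Qed.

(** The radius [1 / (k + 1)] is below half of that of the given box, and rational
    centres are dense. *)
Lemma rational_box_basis (Z : PD R n) (U : set (PD R n)) : nbhs Z U ->
  exists2 c, rational_box c Z & rational_box c `<=` U.
Proof.
move=> /nbhs_PD_box[e e0 eU].
pose k := Num.truncn (2 / e); pose r : R := k.+1%:R^-1.
have re : 2 * r < e.
  have /andP[_] := truncn_itv (divr_ge0 (ler0n R 2) (ltW e0)).
  by rewrite -/k /r ltr_pdivrMr // ltr_pdivrMr // mulrC.
have r0 : 0 < r by rewrite invr_gt0.
have rat_near (x : R) : exists q, `|x - ratr q| < r.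
  have [|q] := @rat_in_itvoo R (x - r) (x + r); first by lra.
  rewrite in_itv /= => /andP[h1 h2]; exists q.
  by rewrite ltr_norml; apply/andP; split; lra.
have /choice[q qP] : forall p : 'I_n * 'I_n, exists q : rat * rat,
    `|ReC (PD_val Z p.1 p.2) - ratr q.1| < r /\
    `|ImC (PD_val Z p.1 p.2) - ratr q.2| < r.
  move=> p; have [q1 h1] := rat_near (ReC (PD_val Z p.1 p.2)).
  by have [q2 h2] := rat_near (ImC (PD_val Z p.1 p.2)); exists (q1, q2).
exists (\matrix_(i, j) q (i, j), k).
  by move=> i j; rewrite !mxE; apply: (qP (i, j)).
move=> W Wq; apply: eU => i j.
have [h1 h2] := qP (i, j); have := Wq i j; rewrite /= mxE -/r => -[h3 h4].
move: h1 h2 h3 h4; rewrite !(ReB, ImB) /= !ltr_norml.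
by move=> /andP[? ?] /andP[? ?] /andP[? ?] /andP[? ?]; split; lra.
Qed.

(** Every point outside the support lies in a rational box of measure zero, and there
    are countably many boxes. *)
Lemma negligible_outside_support : mu.-negligible (~` msupport mu).
Proof.
pose F k : set (PD R n) := if @choice.unpickle code k is Some c then
  (if mu (rational_box c) == 0%E then rational_box c else set0) else set0.
apply: (@negligibleS _ _ _ mu (\bigcup_k F k)); last first.
  apply: negligible_bigcup => k; rewrite /F.
  case: choice.unpickle => [c|]; last exact: negligible_set0.
  have [mu0|_] := eqVneq (mu (rational_box c)) 0%E; last exact: negligible_set0.
  apply/negligibleP => //; apply: measurable_open_PD; exact: open_rational_box.
move=> Z /= /existsNP[U /not_implyP[oU /not_implyP[UZ muU]]].
have [c cZ cU] := rational_box_basis (open_nbhs_nbhs (conj oU UZ)).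
exists (choice.pickle (c : code)) => //; rewrite /F choice.pickleK.
suff -> : mu (rational_box c) = 0%E by rewrite eqxx.
apply/eqP; rewrite -measure_le0.
apply: (@le_trans _ _ (mu U)); last by rewrite leNgt; apply/negP.
by apply: le_measure => //; rewrite inE; apply: measurable_open_PD => //;
  apply: open_rational_box.
Qed.

(** Each point has a neighbourhood inside some order interval, and the intervals
    [[1 / (k + 1), k + 1]] exhaust them all increasingly. *)
Lemma compact_order_itv (K : set (PD R n)) : compact K ->
  exists a b, [/\ 0 < a, 0 < b & K `<=` order_itv a b].
Proof.
move=> /compact_near_coveringP cK.
pose P (k : nat) (Z : PD R n) := order_itv k.+1%:R^-1 k.+1%:R Z.
have [k _ /(_ k (leqnn k)) KP] : \forall k \near \oo, K `<=` P k.
  apply: cK => Z _.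
  have [e e0 eZ] := pd_lower_bound (PD_valP Z).
  have [b b0 Zb] := herm_upper_bound (PD_herm Z).
  have h : \forall W \near Z, order_itv (e / 2) (2 * b) W.
    have := nbhs_relative_order Z (ltr1n R 2); apply: filterS => W [WZ ZW].
    split.
      apply/(loewnerP (herm_scalar _) (PD_herm W)) => z; rewrite qf_scalar.
      have := loewner_qf z eZ; have := loewner_qf z ZW; rewrite qfZ qf_scalar.
      by move: (qf _ z) (qf _ z) (normsq z) => u v s; lra.
    apply/(loewnerP (PD_herm W) (herm_scalar _)) => z; rewrite qf_scalar.
    have := loewner_qf z Zb; have := loewner_qf z WZ; rewrite qfZ qf_scalar.
    by move: (qf _ z) (qf _ z) (normsq z) => u v s; lra.
  pose k0 := (Num.truncn (2 * b) + Num.truncn (2 / e))%N.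
  exists (order_itv (e / 2) (2 * b), [set k | (k0 <= k)%N]).
    by split=> //; exists k0.
  move=> [W k] [/= [We Wb] k0k].
  have kb : 2 * b <= k.+1%:R.
    have /andP[_ /ltW/le_trans] := truncn_itv (mulr_ge0 (ler0n R 2) (ltW b0)).
    by apply; rewrite ler_nat ltnS (leq_trans _ k0k) // leq_addr.
  have ke : k.+1%:R^-1 <= e / 2.
    have /andP[_ /ltW/le_trans h2] := truncn_itv (divr_ge0 (ler0n R 2) (ltW e0)).
    rewrite -[e / 2]invf_div lef_pV2 ?posrE ?divr_gt0 //.
    by apply: h2; rewrite ler_nat ltnS (leq_trans _ k0k) // leq_addl.
  split.
    by apply: loewner_trans We; apply: loewner_scale ke _; apply/pd_psd/pdmx1.
  by apply: loewner_trans Wb _; apply: loewner_scale kb _; apply/pd_psd/pdmx1.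
by exists k.+1%:R^-1, k.+1%:R; split; rewrite ?invr_gt0.
Qed.

Lemma compact_support_order_itv : compact (msupport mu) ->
  exists a b, [/\ 0 < a, 0 < b & mu (~` order_itv a b) = 0%E].
Proof.
move=> /compact_order_itv[a [b [a0 b0 Kab]]]; exists a, b; split=> //.
apply/negligibleP; first by apply: measurableC; apply: measurable_order_itv.
by apply: negligibleS negligible_outside_support; apply: subsetC.
Qed.

End Support.

(** * The mean operator and its fixed point *)

Section MeanOperator.
Context {d : measure_display} {T : measurableType d} {R : realType} {n : nat}.
Variables (P : {measure set T -> \bar R}) (E : set T) (G : T -> PD R n).
Variables (a b t : R).
Hypotheses (P1 : P setT = 1%E) (mE : measurable E) (PE : P (~` E) = 0%E)
  (mG : measurable_fun setT G) (GE : forall x, E x -> order_itv a b (G x))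
  (a0 : 0 < a) (b0 : 0 < b) (t0 : 0 < t) (t1 : t <= 1).
Implicit Types X Y : 'M[R[i]]_n.

Definition mean_op X : 'M[R[i]]_n :=
  mxint P (fun x => geomean t X (PD_val (G x))).

Let t01 : 0 <= t <= 1. Proof. by rewrite ltW. Qed.
Let Pfin : (P setT < +oo)%E. Proof. by rewrite P1 ltry. Qed.

Lemma pd_integrand X x : pdmx X -> pdmx (geomean t X (PD_val (G x))).
Proof. by move=> Xpd; exact: pd_geomean Xpd (PD_valP _). Qed.

Lemma pd_scalar (c : R) : 0 < c -> pdmx (c%:C *: (1%:M : 'M[R[i]]_n)).
Proof. by move=> c0; exact: pdZ c0 (pdmx1 n). Qed.

Lemma borel_integrand X : pdmx X -> borel_mx (fun x => geomean t X (PD_val (G x))).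
Proof.
move=> Xpd U oU; have /continuousP cg := continuous_geomean t01 Xpd.
have mV := measurable_open_PD (cg U oU).
by have := mG measurableT mV; rewrite setTI.
Qed.

(** If [X <= c I] and [G x <= b I], the mean is at most [(c + b) I], since the mean
    of a matrix with itself is that matrix. *)
Lemma mxbounded_integrand X : pdmx X ->
  mxbounded_on E (fun x => geomean t X (PD_val (G x))).
Proof.
move=> Xpd; have Bf := borel_integrand Xpd.
have [c c0 Xc] := herm_upper_bound (pd_herm Xpd).
have cb0 : 0 < c + b by rewrite addr_gt0.
have bnd i j x : E x -> `|ReC (geomean t X (PD_val (G x)) i j)| <= c + b /\
    `|ImC (geomean t X (PD_val (G x)) i j)| <= c + b.
  move=> Ex; have gpd := pd_integrand x Xpd.
  apply: (entry_le_qf _ _ (pd_herm gpd)) => z.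
  rewrite (ger0_norm (pd_qf_ge0 z gpd)) -qf_scalar; apply: loewner_qf.
  have Ipd := pd_scalar cb0.
  have cI (e : R) : e <= c + b -> e%:C *: (1%:M : 'M[R[i]]_n) <<= (c + b)%:C *: 1%:M.
    by move=> eb; exact: loewner_scale eb (pd_psd (pdmx1 n)).
  rewrite -(geomean_id t Ipd); apply: (geomean_le t01 Xpd (PD_valP _) Ipd Ipd).
    by apply: loewner_trans Xc _; apply: cI; rewrite lerDl ltW.
  by apply: loewner_trans (GE Ex).2 _; apply: cI; rewrite lerDr ltW.
move=> i j; split; split.
- exact: (borel_comp Bf (@continuous_Re_entry R n i j)).
- by exists (c + b) => x Ex; have [] := bnd i j x Ex.
- exact: (borel_comp Bf (@continuous_Im_entry R n i j)).
- by exists (c + b) => x Ex; have [] := bnd i j x Ex.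
Qed.

Lemma mxbounded_cst (A : 'M[R[i]]_n) : mxbounded_on E (fun=> A).
Proof.
move=> i j; split; split; try exact: measurable_cst.
  by exists `|ReC (A i j)|.
by exists `|ImC (A i j)|.
Qed.

Lemma herm_mean_op X : pdmx X -> (mean_op X)^t* = mean_op X.
Proof.
move=> Xpd; apply: (herm_mxint Pfin mE PE (mxbounded_integrand Xpd)) => x.
exact/pd_herm/pd_integrand.
Qed.

Lemma mean_op_le X Y : pdmx X -> pdmx Y -> X <<= Y -> mean_op X <<= mean_op Y.
Proof.
move=> Xpd Ypd XY.
apply: (le_mxint Pfin mE PE (mxbounded_integrand Xpd) (mxbounded_integrand Ypd)).
- by move=> x; exact: pd_herm (pd_integrand x Xpd).
- by move=> x; exact: pd_herm (pd_integrand x Ypd).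
- move=> x _; have Gpd := PD_valP (G x).
  exact: (geomean_le t01 Xpd Gpd Ypd Gpd XY (loewner_refl _)).
Qed.

(** Order intervals between scalar matrices are stable under the operator, which
    keeps the iteration away from singular matrices. *)
Lemma mean_op_scalar_ge (e : R) X : 0 < e -> e <= a -> pdmx X ->
  e%:C *: 1%:M <<= X -> e%:C *: 1%:M <<= mean_op X.
Proof.
move=> e0 ea Xpd eX; have Ipd := pd_scalar e0.
rewrite -[X in X <<= _](mxint_cst _ P1) /mean_op.
apply: (le_mxint Pfin mE PE (mxbounded_cst _) (mxbounded_integrand Xpd)).
- by move=> x; exact: pd_herm Ipd.
- by move=> x; exact: pd_herm (pd_integrand x Xpd).
move=> x Ex; rewrite -[X in X <<= _](geomean_id t Ipd).
apply: (geomean_le t01 Ipd Ipd Xpd (PD_valP _) eX).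
apply: loewner_trans (GE Ex).1; exact: loewner_scale ea (pd_psd (pdmx1 n)).
Qed.

Lemma mean_op_scalar_le X : pdmx X ->
  X <<= b%:C *: 1%:M -> mean_op X <<= b%:C *: 1%:M.
Proof.
move=> Xpd Xb; have Ipd := pd_scalar b0.
rewrite -[X in _ <<= X](mxint_cst _ P1) /mean_op.
apply: (le_mxint Pfin mE PE (mxbounded_integrand Xpd) (mxbounded_cst _)).
- by move=> x; exact: pd_herm (pd_integrand x Xpd).
- by move=> x; exact: pd_herm Ipd.
move=> x Ex; rewrite -[X in _ <<= X](geomean_id t Ipd).
exact: (geomean_le t01 Xpd (PD_valP _) Ipd Ipd Xb (GE Ex).2).
Qed.

Lemma pd_mean_op X : pdmx X -> pdmx (mean_op X).
Proof.
move=> Xpd; have [e e0 eX] := pd_lower_bound Xpd.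
have m0 : 0 < Num.min e a by rewrite lt_min e0.
apply: (pd_loewner (pd_scalar m0)); apply: (mean_op_scalar_ge m0 _ Xpd).
  by rewrite ge_min lexx orbT.
apply: loewner_trans eX; apply: loewner_scale (pd_psd (pdmx1 n)).
by rewrite ge_min lexx.
Qed.

Lemma mean_op_scale (c : R) X : 0 < c -> pdmx X ->
  mean_op (c%:C *: X) = (c `^ (1 - t))%:C *: mean_op X.
Proof.
move=> c0 Xpd; pose k := c `^ (1 - t).
have := @linear_mxint _ _ R n n P E Pfin mE PE (fun A => k%:C *: A)
  (fun x => geomean t X (PD_val (G x))).
move=> /(_ _ _ (mxbounded_integrand Xpd)) ->.
- congr mxint; apply/funext => x /=.
  have := geomean_scale t c0 ltr01 Xpd (PD_valP (G x)).
  by rewrite scale1r powR1 mulr1.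
- by move=> A B; rewrite scalerDr.
- by move=> r A; rewrite !scalerA mulrC.
Qed.

(** If [X <= c Y] then [X <= mean_op X <= c ^ (1 - t) mean_op Y], so the least
    such [c >= 1] is [1]. *)
Lemma mean_op_compare X Y : pdmx X -> pdmx Y ->
  X <<= mean_op X -> mean_op Y <<= Y -> X <<= Y.
Proof.
move=> Xpd Ypd XF FY; have hX := pd_herm Xpd; have hY := pd_herm Ypd.
(* The constraint [1 <= c] makes [c ^ (1 - t) >= 1], so that it stays in [C]. *)
pose C := [set c : R | 1 <= c /\ X <<= c%:C *: Y].
have [q q0 Xq] := herm_upper_bound hX; have [e e0 eY] := pd_lower_bound Ypd.
have C0 : C !=set0.
  exists (1 + q / e); split; first by rewrite lerDl divr_ge0 // ltW.
  apply: loewner_trans Xq _.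
  have -> : q%:C *: (1%:M : 'M[R[i]]_n) = (q / e)%:C *: (e%:C *: 1%:M).
    by rewrite scalerA -rmorphM divfK // gt_eqF.
  apply: (@loewner_trans _ _ ((q / e)%:C *: Y)).
    by apply: loewnerZ eY; rewrite divr_ge0 // ltW.
  by apply: loewner_scale (pd_psd Ypd); rewrite lerDr.
have Clb : has_lbound C by exists 1 => c [].
pose c0 := inf C.
have c01 : 1 <= c0 by apply: lb_le_inf => // c [].
have c0gt : 0 < c0 by apply: lt_le_trans c01.
have Xc0 : X <<= c0%:C *: Y.
  apply/(loewnerP hX (_ : _^t* = _)) => [|z]; first by rewrite trmxCZ hY.
  rewrite qfZ; have [->|z0] := eqVneq z 0; first by rewrite !qf0 mulr0.
  have [_ /(_ z z0) Yz] := (pdP Y).1 Ypd.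
  rewrite -ler_pdivrMr //; apply: lb_le_inf => // c [_ Xc].
  by rewrite ler_pdivrMr // -qfZ; apply: loewner_qf.
have Xc0' : X <<= (c0 `^ (1 - t))%:C *: Y.
  apply: loewner_trans XF _.
  apply: (loewner_trans (mean_op_le Xpd (pdZ c0gt Ypd) Xc0)).
  rewrite (mean_op_scale c0gt Ypd); apply: loewnerZ FY; exact: powR_ge0.
have c0' : c0 <= c0 `^ (1 - t).
  apply: ge_inf => //; split=> //.
  by rewrite -[leLHS](powRr0 c0) ler_powR // subr_ge0.
have c0E : c0 = 1.
  apply/eqP; rewrite eq_le c01 andbT leNgt; apply/negP => c0gt1.
  have ct : 1 < c0 `^ t.
    have : 1 `^ t < c0 `^ t by rewrite gt0_ltr_powR // nnegrE ltW.
    by rewrite powR1.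
  have cE : c0 = c0 `^ (1 - t) * c0 `^ t.
    by rewrite -powRD_gt0 // subrK powRr1 // ltW.
  by move: c0'; rewrite [leLHS]cE ger_pMr ?powR_gt0 // leNgt ct.
by move: Xc0; rewrite c0E scale1r.
Qed.

Let iterate k := iter k mean_op (b%:C *: 1%:M).

Lemma iterate_pd k : pdmx (iterate k).
Proof. by elim: k => [|k IH]; [exact: pd_scalar | exact: pd_mean_op IH]. Qed.

Lemma iterate_decreasing k l : (k <= l)%N -> iterate l <<= iterate k.
Proof.
have step j : iterate j.+1 <<= iterate j.
  elim: j => [|j IH].
    by apply: (mean_op_scalar_le (pd_scalar b0)); exact: loewner_refl.
  exact: mean_op_le (iterate_pd _) (iterate_pd _) IH.
elim: l => [|l IH]; first by rewrite leqn0 => /eqP ->; exact: loewner_refl.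
rewrite leq_eqVlt => /orP[/eqP ->|]; first exact: loewner_refl.
by rewrite ltnS => /IH; exact: loewner_trans (step l).
Qed.

Let e := Num.min a b.
Let e0 : 0 < e. Proof. by rewrite lt_min a0. Qed.

(** The least of [a] and [b] is used, as the iteration starts from [b I]. *)
Lemma iterate_lower k : e%:C *: 1%:M <<= iterate k.
Proof.
elim: k => [|k IH].
  by apply: loewner_scale (pd_psd (pdmx1 n)); rewrite ge_min lexx orbT.
by apply: mean_op_scalar_ge e0 _ (iterate_pd k) IH; rewrite ge_min lexx.
Qed.

(** The decreasing sequence of iterates from [b I] converges entrywise by
    polarisation. *)
Lemma iterate_cvg : exists X : 'M[R[i]]_n,
  [/\ X^t* = X, forall z, qf (iterate k) z @[k --> \oo] --> qf X z &
    forall r : R, 0 < r -> exists k, forall i j,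
      `|ReC ((iterate k - X) i j)| <= r /\ `|ImC ((iterate k - X) i j)| <= r].
Proof.
have qcvg z : cvgn (fun k => qf (iterate k) z).
  apply: nonincreasing_is_cvgn.
    by move=> k l kl; apply: loewner_qf; exact: iterate_decreasing.
  by exists 0 => _ [k _ <-]; apply: pd_qf_ge0; exact: iterate_pd.
have sE k x y : sform (iterate k) x y =
    (qf (iterate k) (x + y) - qf (iterate k) (x - y)) / 4.
  rewrite -(sform_polar _ _ (pd_herm (iterate_pd k))) mulrAC mulfV ?mul1r //.
have scvg x y : cvgn (fun k => sform (iterate k) x y).
  under eq_fun do rewrite sE.
  by apply: is_cvgMl; apply: is_cvgB; apply: qcvg.
have Rcvg i j : cvgn (fun k => ReC (iterate k i j)).
  by under eq_fun do rewrite -sform_delta; apply: scvg.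
have Icvg i j : cvgn (fun k => ImC (iterate k i j)).
  under eq_fun do rewrite -[ImC _]opprK -sform_idelta.
  by apply: is_cvgN; apply: scvg.
pose X : 'M[R[i]]_n := \matrix_(i, j)
  (limn (fun k => ReC (iterate k i j)) +i* limn (fun k => ImC (iterate k i j))).
have itH k i j : iterate k i j = (iterate k j i)^*%C.
  by rewrite -{1}(pd_herm (iterate_pd k)) !mxE.
exists X; split.
- apply/matrixP => i j; rewrite !mxE /=; apply: complexP => /=.
    by congr (limn _); apply/funext => k; rewrite [in RHS]itH; case: (iterate k j i).
  have -> : (fun k => ImC (iterate k i j)) = (fun k => - ImC (iterate k j i)).
    by apply/funext => k; rewrite itH; case: (iterate k j i).
  by rewrite limN //; exact: Icvg.
- move=> z.
  have lin (A : 'M[R[i]]_n) := @real_linear_entries R n (fun A => qf A z)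
  (fun A B => qfD A B z) (fun c A => qfZ c A z) A.
  rewrite lin; under eq_fun do rewrite lin.
  apply: cvg_big => [|p _]; first exact: add_continuous.
  by rewrite !mxE; apply: cvgD; apply: cvgMl; [exact: Rcvg | exact: Icvg].
- move=> r r0.
  pose close (p : 'I_n * 'I_n) := [set k : nat |
    `|ReC ((iterate k - X) p.1 p.2)| <= r /\
    `|ImC ((iterate k - X) p.1 p.2)| <= r].
  have near_close : \forall k \near \oo, forall p, close p k.
    apply: (@filter_forall _ _ close) => -[i j].
    have /cvgrPdist_le/(_ r r0) Rr := Rcvg i j.
    have /cvgrPdist_le/(_ r r0) Ir := Icvg i j.
    apply: filterS2 Rr Ir => k Rk Ik; rewrite /close /= !mxE ReB ImB /=.
    by rewrite distrC [X in _ /\ X <= _]distrC.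
  by have [k kP] := filter_ex near_close; exists k => i j; apply: (kP (i, j)).
Qed.

(** The limit [X] is below every iterate, so [mean_op X <= X].  Conversely, for every
    [c > 1] some iterate is below [c X], whence [X <= c mean_op X] by homogeneity. *)
Lemma mean_op_fixpoint : exists2 X, pdmx X & mean_op X = X.
Proof.
have [X [hX Xlim Xclose]] := iterate_cvg.
have eX : e%:C *: 1%:M <<= X.
  apply/(loewnerP (herm_scalar _) hX) => z.
  rewrite -(cvg_lim _ (Xlim z)) //; apply: limr_ge.
    by apply/cvg_ex; exists (qf X z).
  by apply: nearW => k; apply: loewner_qf; exact: iterate_lower.
have Xpd : pdmx X := pd_loewner (pd_scalar e0) eX.
have Xle k : X <<= iterate k.
  apply/(loewnerP hX (pd_herm (iterate_pd k))) => z.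
  rewrite -(cvg_lim _ (Xlim z)) //; apply: nonincreasing_cvgn_ge.
    by move=> i j ij; apply: loewner_qf; exact: iterate_decreasing.
  by apply/cvg_ex; exists (qf X z).
exists X => //; apply: (loewner_anti (herm_mean_op Xpd) hX).
  apply/(loewnerP (herm_mean_op Xpd) hX) => z.
  rewrite -(cvg_lim _ (Xlim z)) //; apply: limr_ge.
    by apply/cvg_ex; exists (qf X z).
  exists 1%N; first by [].
  move=> k k1; rewrite -(prednK k1); apply: loewner_qf.
  exact: mean_op_le Xpd (iterate_pd _) (Xle _).
have FXpd := pd_mean_op Xpd.
have XcF c : 1 < c -> X <<= c%:C *: mean_op X.
  move=> c1; have c0 : 0 < c by apply: lt_trans c1.
  (* Entries within [r] give forms within [(c - 1) e I <= (c - 1) X]. *)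
  pose r := (c - 1) * e / (2 * n%:R + 1).
  have n0 : 0 < 2 * n%:R + 1 :> R by rewrite ltr_wpDl // mulr_ge0.
  have [|k kr] := Xclose r; first by rewrite divr_gt0 // mulr_gt0 // subr_gt0.
  have it_le : iterate k <<= c%:C *: X.
    apply/(loewnerP (pd_herm (iterate_pd k)) (pd_herm (pdZ c0 Xpd))) => z.
    rewrite qfZ; have := qf_le_entries kr z; rewrite qfB => /(le_trans (ler_norm _)).
    have := loewner_qf z eX; rewrite qf_scalar.
    have rn : 2 * n%:R * r * normsq z <= (c - 1) * (e * normsq z).
      rewrite [leRHS]mulrA; apply: ler_wpM2r; first exact: normsq_ge0.
      rewrite /r [leLHS]mulrA ler_pdivrMr // mulrC; apply: ler_wpM2l.
        by apply: mulr_ge0; [rewrite subr_ge0|]; apply: ltW.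
      by rewrite lerDl.
    move=> eXz; have : (c - 1) * (e * normsq z) <= (c - 1) * qf X z.
      by apply: ler_wpM2l => //; rewrite subr_ge0 ltW.
    move: rn; move: (qf _ z) (qf X z) (2 * _ * _ * _) (_ * (e * _)) => u v p q; lra.
  apply: (loewner_trans (Xle k.+1)).
  apply: (loewner_trans (mean_op_le (iterate_pd k) (pdZ c0 Xpd) it_le)).
  rewrite (mean_op_scale c0 Xpd); apply: loewner_scale (pd_psd FXpd).
  by apply: ler1_powR; [exact: ltW | rewrite gerBl ltW].
apply/(loewnerP hX (pd_herm FXpd)) => z; apply/ler_addgt0Pr => r r0.
have v0 := pd_qf_ge0 z FXpd; set v := qf (mean_op X) z in v0 *.
have v1 : 0 < v + 1 by rewrite ltr_wpDl.
have /(loewner_qf z) : X <<= (1 + r / (v + 1))%:C *: mean_op X.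
  by apply: XcF; rewrite ltrDl divr_gt0.
rewrite qfZ -/v mulrDl mul1r => /le_trans; apply; rewrite lerD2l.
by rewrite mulrAC ler_pdivrMr // ler_wpM2l ?lerDl // ltW.
Qed.

End MeanOperator.

(** * Power means of image measures *)

Definition image_measure {d d' : measure_display} {T : measurableType d}
    {T' : measurableType d'} {R : realType} (P : {measure set T -> \bar R})
    (G : T -> T') (mG : measurable_fun setT G) : {measure set T' -> \bar R} :=
  measure_function_pushforward__canonical__measure_function_Measure P mG.

Section ChangeOfVariables.
Context {d : measure_display} {T : measurableType d} {R : realType} {n : nat}.
Variables (P : {measure set T -> \bar R}) (E : set T) (G : T -> PD R n).
Variables (a b t : R).
Hypotheses (P1 : P setT = 1%E) (mE : measurable E) (PE : P (~` E) = 0%E)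
  (mG : measurable_fun setT G) (GE : forall x, E x -> order_itv a b (G x))
  (a0 : 0 < a) (b0 : 0 < b) (t0 : 0 < t) (t1 : t <= 1).
Variable lam : {measure set (PD R n) -> \bar R}.
Hypothesis lamE : forall F, measurable F -> lam F = P (G @^-1` F).

Let lam1 : lam setT = 1%E.
Proof. by rewrite lamE ?preimage_setT. Qed.

Let lamI : lam (~` order_itv a b) = 0%E.
Proof.
have mI := measurableC (@measurable_order_itv R n a b).
rewrite lamE //; apply/eqP; rewrite -measure_le0 -[leRHS]PE.
apply: le_measure; rewrite ?inE.
- by rewrite -[X in measurable X]setTI; apply: mG.
- exact: measurableC.
- by move=> x /= nI Ex; apply: nI; apply: GE.
Qed.

(** Two measures that agree on measurable sets have the same integrals, and the image
    measure is computed by change of variables. *)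
Lemma Rintegral_image (h : PD R n -> R) : bounded_on (order_itv a b) h ->
  (\int[lam]_x h x = \int[P]_x h (G x))%R.
Proof.
move=> [mh [M hM]]; rewrite /Rintegral; congr fine.
rewrite (@eq_measure_integral _ _ _ setT (image_measure P mG)); last first.
  by move=> A mA _; apply: lamE.
rewrite integral_pushforward //; first exact/measurable_EFinP.
have bh : bounded_on E (h \o G).
  split; first exact: measurableT_comp.
  by exists M => x Ex; apply: hM; apply: GE.
by apply: (bounded_on_integrable _ mE PE bh); rewrite P1 ltry.
Qed.

(** The measure [lam] is any measure that agrees with the image of [P] by [G] on
    measurable sets; the Bochner equation for [lam] becomes a fixed point equation
    for an integral against [P]. *)
Lemma is_power_meanE (X : PD R n) :
  is_power_mean lam t X <-> mean_op P G t (PD_val X) = PD_val X.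
Proof.
have lam_fin : (lam setT < +oo)%E by rewrite lam1 ltry.
have mI := @measurable_order_itv R n a b.
have mid : measurable_fun setT (@id (PD R n)) by exact: measurable_id.
have Xpd := PD_valP X.
have bf := @mxbounded_integrand _ _ _ _ (order_itv a b) id a b t mid
  (fun x Ix => Ix) b0 t0 t1 _ Xpd.
have Bf := @borel_integrand _ _ _ _ id t mid t0 t1 _ Xpd.
have <- : mxint lam (fun Z => geomean t (PD_val X) (PD_val Z)) = mean_op P G t (PD_val X).
  apply/matrixP => i j; rewrite !mxE; have [bR bI] := bf i j.
  by rewrite (Rintegral_image bR) (Rintegral_image bI).
split=> [/(bochner_integral_eq lam_fin mI lamI bf) <- //|E'].
rewrite /is_power_mean -[X in has_bochner_integral _ _ X]E'.
exact: (has_bochner_integral_mxint lam_fin mI lamI Bf bf).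
Qed.

(** A power mean is a chosen solution; it solves the equation because a solution
    exists. *)
Lemma power_mean_posE (Y := PD_val (power_mean_pos lam t)) :
  mean_op P G t Y = Y.
Proof.
apply/is_power_meanE; rewrite /power_mean_pos.
apply: (@getPex _ [set X | is_power_mean lam t X]).
have [X Xpd XF] := mean_op_fixpoint P1 mE PE mG GE a0 b0 t0 t1.
by exists (mkPD Xpd); apply/is_power_meanE.
Qed.

End ChangeOfVariables.

(** * Inversion of positive definite matrices *)

Section PDMaps.
Context {R : realType} {n : nat}.

Lemma PD_val_inj : injective (@PD_val R n).
Proof. exact: val_inj. Qed.

Lemma PD_invK : involutive (@PD_inv R n).
Proof. by move=> Z; apply: PD_val_inj; exact: invmxK. Qed.

Lemma measurable_PD_inv : measurable_fun setT (@PD_inv R n).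
Proof.
apply: measurable_to_PD; apply: continuous_borel; exact: continuous_PD_inv.
Qed.

(** Inversion is an involution, so images and preimages under it agree. *)
Lemma inv_measureE (mu : set (PD R n) -> \bar R) :
  inv_measure mu = pushforward mu (@PD_inv R n).
Proof.
apply/funext => F; rewrite /inv_measure /pushforward; congr mu.
apply/seteqP; split => [_ [Z FZ <-]|Z FZ]; first by rewrite /= PD_invK.
by exists (PD_inv Z) => //; rewrite PD_invK.
Qed.

Lemma order_itv_inv (a b : R) (Z : PD R n) : 0 < a -> 0 < b ->
  order_itv a b Z -> order_itv b^-1 a^-1 (PD_inv Z).
Proof.
move=> a0 b0 [aZ Zb]; have Zpd := PD_valP Z.
have scalV (c : R) : 0 < c ->
    invmx (c%:C *: 1%:M : 'M[R[i]]_n) = (c^-1)%:C *: 1%:M.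
  move=> c0; rewrite invmxZ ?invmx1; last exact/pdmx_unit/pdZ/pdmx1.
  by rewrite -fmorphV.
split.
  by rewrite -(scalV b b0); apply: loewner_inv Zpd (pdZ b0 (pdmx1 n)) Zb.
by rewrite -(scalV a a0); apply: loewner_inv (pdZ a0 (pdmx1 n)) Zpd aZ.
Qed.

End PDMaps.

(** * Images of power means under unital positive maps *)

Section UnitalPositiveImage.
Context {R : realType} {n m : nat}.
Variable Phi : {linear 'M[R[i]]_n -> 'M[R[i]]_m}.
Hypotheses (Phi_unital : unital_map Phi) (Phi_positive : positive_map Phi).

Definition PD_map (Z : PD R n) : PD R m :=
  mkPD (map_pd Phi_positive Phi_unital (PD_valP Z)).

Lemma linear_realZ (c : R) A : Phi (c%:C *: A) = c%:C *: Phi A.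
Proof. exact: linearZ. Qed.

Lemma measurable_PD_map : measurable_fun setT PD_map.
Proof.
apply: measurable_to_PD; apply: continuous_borel.
apply: relative_order_continuous.
  by move=> Z; exact: PD_valP.
by move=> c Z W c1 ZW _; have := map_loewner Phi_positive ZW; rewrite linear_realZ.
Qed.

Lemma order_itv_map (a b : R) (Z : PD R n) :
  order_itv a b Z -> order_itv a b (PD_map Z).
Proof.
move=> [aZ Zb]; have scal (c : R) : c%:C *: 1%:M = Phi (c%:C *: 1%:M).
  by rewrite linear_realZ Phi_unital.
by split; rewrite scal; apply: map_loewner.
Qed.

Variables (mu : {measure set (PD R n) -> \bar R}) (a b : R).
Hypotheses (mu1 : mu setT = 1%E) (a0 : 0 < a) (b0 : 0 < b)
  (muI : mu (~` order_itv a b) = 0%E).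
Variable t : R.
Hypotheses (t0 : 0 < t) (t1 : t <= 1).

Let t01 : 0 <= t <= 1. Proof. by rewrite ltW. Qed.
Let mu_fin : (mu setT < +oo)%E. Proof. by rewrite mu1 ltry. Qed.
Let mI := @measurable_order_itv R n a b.
Let mid : measurable_fun setT (@id (PD R n)). Proof. exact: measurable_id. Qed.

(** Ando's inequality under the integral: the image of a fixed point is a
    subsolution. *)
Lemma map_fixpoint_le X Y : pdmx X -> pdmx Y ->
  mean_op mu id t X = X -> mean_op mu PD_map t Y = Y -> Phi X <<= Y.
Proof.
move=> Xpd Ypd XF YF; have PXpd := map_pd Phi_positive Phi_unital Xpd.
apply: (mean_op_compare mu1 mI muI measurable_PD_map
  (fun Z IZ => order_itv_map IZ) b0 t0 t1 PXpd Ypd); last first.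
  by rewrite YF; exact: loewner_refl.
have bf := mxbounded_integrand mid (fun x Ix => Ix) b0 t0 t1 Xpd (E := order_itv a b).
have PhiD A B : Phi (A + B) = Phi A + Phi B by exact: linearD.
rewrite -{1}XF (linear_mxint mu_fin mI muI PhiD linear_realZ bf).
apply: (le_mxint mu_fin mI muI (mxbounded_on_linear PhiD linear_realZ bf)
  (mxbounded_integrand measurable_PD_map (fun Z IZ => order_itv_map IZ)
     b0 t0 t1 PXpd)).
- by move=> Z; exact: (map_herm_pd Phi_positive (pd_geomean t Xpd (PD_valP Z))).
- by move=> Z; exact: pd_herm (pd_geomean t PXpd (PD_valP (PD_map Z))).
- move=> Z _; apply: (map_geomean Phi_positive t01 Xpd (PD_valP Z) PXpd
    (PD_valP (PD_map Z)) (loewner_refl _) (loewner_refl _)).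
Qed.

(** The inverse means: [Phi (X^-1)^-1] is a supersolution, since the concave map
    [A |-> Phi (A^-1)^-1] lies below its linear tangent at the fixed point. *)
Lemma map_inv_fixpoint_le X Y : pdmx X -> pdmx Y ->
  mean_op mu (@PD_inv R n) t X = X ->
  mean_op mu (@PD_inv R m \o PD_map) t Y = Y ->
  Y <<= invmx (Phi (invmx X)).
Proof.
move=> Xpd Ypd XF YF.
have Vpd := pdmx_inv Xpd; have PVpd := map_pd Phi_positive Phi_unital Vpd.
have Y0pd := pdmx_inv PVpd; set Y0 := invmx _ in Y0pd *.
have mG : measurable_fun setT (@PD_inv R m \o PD_map).
  by apply: measurableT_comp; [exact: measurable_PD_inv | exact: measurable_PD_map].
have GE Z : order_itv a b Z -> order_itv b^-1 a^-1 ((@PD_inv R m \o PD_map) Z).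
  by move=> IZ; apply: order_itv_inv a0 b0 _; exact: order_itv_map.
have a0' : 0 < a^-1 by rewrite invr_gt0.
apply: (mean_op_compare mu1 mI muI mG GE a0' t0 t1 Ypd Y0pd).
  by rewrite YF; exact: loewner_refl.
have GE' Z : order_itv a b Z -> order_itv b^-1 a^-1 (@PD_inv R n Z).
  exact: order_itv_inv.
have bf := mxbounded_integrand (@measurable_PD_inv R n) GE' a0' t0 t1 Xpd.
pose L A := Y0 *m Phi (invmx X *m A *m invmx X) *m Y0.
have LD A B : L (A + B) = L A + L B.
  by rewrite /L mulmxDr mulmxDl linearD mulmxDr mulmxDl.
have LZ (c : R) A : L (c%:C *: A) = c%:C *: L A.
  by rewrite /L -scalemxAr -scalemxAl linear_realZ -scalemxAr -scalemxAl.
have LX : L X = Y0.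
  by rewrite /L mulVmx ?pdmx_unit // mul1mx mulVmx ?mul1mx // pdmx_unit.
(* The linear map [L] is the tangent bound, exact at [X]. *)
rewrite -[X in _ <<= X]LX -[X in _ <<= L X]XF.
rewrite (linear_mxint mu_fin mI muI LD LZ bf).
have gpd Z := pd_geomean t Xpd (PD_valP (PD_inv Z)).
have Lherm Z : (L (geomean t X (PD_val (PD_inv Z))))^t* =
    L (geomean t X (PD_val (PD_inv Z))).
  have hV := pd_herm Vpd; have hY0 := pd_herm Y0pd.
  rewrite /L -{1 3}hY0; apply: psd_herm; apply: psd_congr; apply: Phi_positive.
  by rewrite -{1}hV; apply: psd_congr; exact: pd_psd (gpd Z).
apply: (le_mxint mu_fin mI muI
  (mxbounded_integrand mG GE a0' t0 t1 Y0pd) (mxbounded_on_linear LD LZ bf)).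
- by move=> Z; exact: pd_herm (pd_geomean t Y0pd (PD_valP _)).
- exact: Lherm.
move=> Z _; have Zpd := PD_valP Z; have Zpd' := pdmx_inv Zpd.
have PZpd := PD_valP (PD_map Z).
have -> : geomean t Y0 (PD_val ((@PD_inv R m \o PD_map) Z)) =
    invmx (geomean t (Phi (invmx X)) (PD_val (PD_map Z))).
  exact: geomean_inv PVpd PZpd.
have VZ : geomean t (invmx X) (PD_val Z) = invmx (geomean t X (invmx (PD_val Z))).
  by rewrite -(geomean_inv t Xpd Zpd') invmxK.
apply: (loewner_trans (B := invmx (Phi (geomean t (invmx X) (PD_val Z))))).
  apply: loewner_inv.
  - exact: (map_pd Phi_positive Phi_unital (pd_geomean t Vpd Zpd)).
  - exact: pd_geomean PVpd PZpd.
  - exact: (map_geomean Phi_positive t01 Vpd Zpd PVpd PZpd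
      (loewner_refl _) (loewner_refl _)).
by rewrite VZ; apply: map_inv_supporting Xpd (gpd Z).
Qed.

End UnitalPositiveImage.

Theorem theorem2p9 (R : realType) (n m : nat)
    (mu : probability (PD R n) R)
    (mu_compact : compact (msupport mu))
    (Phi : {linear 'M[R[i]]_n -> 'M[R[i]]_m})
    (Phi_unital : unital_map Phi)
    (Phi_positive : positive_map Phi)
    (nu : probability (PD R m) R)
    (nu_def : forall F : set (PD R m), measurable F ->
       nu F = mu [set Z : PD R n | exists2 W : PD R m, F W & Phi Z = W])
    (t : R) (t_ge : -1 <= t) (t_le : t <= 1) (t_neq0 : t != 0) :
  loewner_le (Phi (power_mean mu t)) (power_mean nu t).
Proof.
have [a [b [a0 b0 muI]]] := compact_support_order_itv mu_compact.
have mu1 : mu setT = 1%E by exact: probability_setT.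
have mI := @measurable_order_itv R n a b.
pose phi := PD_map Phi_unital Phi_positive.
have mphi : measurable_fun setT phi by exact: measurable_PD_map.
have phiI Z : order_itv a b Z -> order_itv a b (phi Z) by exact: order_itv_map.
have nuE F : measurable F -> nu F = mu (phi @^-1` F).
  move=> mF; rewrite nu_def //; congr (mu _); apply/seteqP; split => [Z [W FW ZW]|Z FZ].
    by rewrite /= (_ : phi Z = W) //; apply: PD_val_inj.
  by exists (phi Z).
rewrite /power_mean; have [t0|t0'] := ltP 0 t.
  set X := power_mean_pos mu t; set Y := power_mean_pos nu t.
  have XF : mean_op mu id t (PD_val X) = PD_val X.
    have mid : measurable_fun setT (@id (PD R n)) by exact: measurable_id.
    by apply: (@power_mean_posE _ _ R n mu (order_itv a b) id a b t
      mu1 mI muI mid (fun Z IZ => IZ) a0 b0 t0 t_le mu).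
  have YF : mean_op mu phi t (PD_val Y) = PD_val Y.
    exact: (power_mean_posE mu1 mI muI mphi phiI a0 b0 t0 t_le nuE).
  exact: (map_fixpoint_le mu1 b0 muI t0 t_le (PD_valP X) (PD_valP Y) XF YF).
have s0 : 0 < - t by rewrite oppr_gt0 lt_def eq_sym t_neq0.
have s1 : - t <= 1 by rewrite lerNl.
have a0' : 0 < a^-1 by rewrite invr_gt0.
have b0' : 0 < b^-1 by rewrite invr_gt0.
rewrite !inv_measureE; set s := - t in s0 s1 *.
have minv := @measurable_PD_inv R n; have minv' := @measurable_PD_inv R m.
set X := power_mean_pos (pushforward mu _) s.
set Y := power_mean_pos (pushforward nu _) s.
have mG : measurable_fun setT (@PD_inv R m \o phi) by exact: measurableT_comp.
have XF : mean_op mu (@PD_inv R n) s (PD_val X) = PD_val X.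
  exact: (@power_mean_posE _ _ R n mu (order_itv a b) (@PD_inv R n) b^-1 a^-1 s
    mu1 mI muI minv (fun Z IZ => order_itv_inv a0 b0 IZ) b0' a0' s0 s1
    (image_measure mu minv) (fun F mF => erefl)).
have YF : mean_op mu (@PD_inv R m \o phi) s (PD_val Y) = PD_val Y.
  have nuE' F : measurable F ->
      pushforward nu (@PD_inv R m) F = mu ((@PD_inv R m \o phi) @^-1` F).
    move=> mF; have mF' := minv' measurableT F mF.
    by rewrite setTI in mF'; exact: nuE mF'.
  exact: (@power_mean_posE _ _ R m mu (order_itv a b) (@PD_inv R m \o phi)
    b^-1 a^-1 s mu1 mI muI mG
    (fun Z IZ => order_itv_inv a0 b0 (phiI Z IZ)) b0' a0' s0 s1
    (image_measure nu minv') nuE').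
have Xpd := PD_valP X; have Ypd := PD_valP Y.
have YX := map_inv_fixpoint_le mu1 a0 b0 muI s0 s1 Xpd Ypd XF YF.
have PVpd := map_pd Phi_positive Phi_unital (pdmx_inv Xpd).
have := loewner_inv Ypd (pdmx_inv PVpd) YX.
by rewrite invmxK.
Qed.
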